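(* Let $k\ge2$ be an integer. (a) For $n\ge 1$, the number of $\pi\in S_n$ avoiding the consecutive pattern $\underline{k\dots1}$ is equal to $\langle h_1^n,\widetilde g_n\rangle$. (b) For $n\ge1$ and $\lambda\vdash n$, the number of $\pi\in S_n$ avoiding the consecutive pattern $\underline{k\dots1}$ with cycle type $\lambda$ is equal to $\langle L_\lambda,\widetilde g_n\rangle$. (c) $\widetilde g_n=\sum_{\mu\vDash n}\chi_\mu e_\mu$, and \[ \sum_{n\ge0}\widetilde g_n=\left(1-\sum_{r\ge1}\chi_r e_r\right)^{-1}=\frac{1}{1-e_1+e_k-e_{k+1}+e_{2k}-e_{2k+1}+\cdots}. \]
   Context: $[n]=\{1,\dots,n\}$, $S_n$ is the symmetric group on $[n]$; $\lambda\vdash n$ means $\lambda$ is a partition of $n$, and $\mu\vDash n$ means $\mu$ is a composition of $n$ (finite sequence of positive integers with sum $n$). A permutation avoids the consecutive pattern $\underline{k\dots1}$ if it does not have $k-1$ consecutive descents, i.e. there is no $i$ with $\pi(i)>\pi(i+1)>\cdots>\pi(i+k-1)$. The cycle type of $\pi$ is the partition of $n$ whose parts are the lengths of its cycles. Symmetric functions are in variables $x_1,x_2,\dots$; $\langle\cdot,\cdot\rangle$ is the usual (Hall) inner product, $h_r,e_r$ are the complete homogeneous and elementary symmetric functions, and $e_\mu=e_{\mu_1}e_{\mu_2}\cdots$ for a composition $\mu$. For $I\subseteq[n-1]$, \[ s_I=\sum x_{a_1}\cdots x_{a_n}, \] where the sum is over sequences of positive integers $(a_1,\dots,a_n)$ with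 $a_i\le a_{i+1}$ if $i\in[n-1]\smallsetminus I$ and $a_i>a_{i+1}$ if $i\in I$ (this is a border-strip skew Schur function). For $I=\{i_1<\dots<i_{t-1}\}\subseteq[n-1]$, $\mathrm{co}(I)=(i_1,i_2-i_1,\dots,i_{t-1}-i_{t-2},n-i_{t-1})$ is the associated composition of $n$. Set $G_n=\{I\subseteq[n-1]:\text{every part of }\mathrm{co}(I)\text{ is }<k\}$ and $\widetilde g_n=\sum_{I\in G_n}s_{\overline I}$, where $\overline I=[n-1]\smallsetminus I$; for $n=0$, $\widetilde g_0=1$. For $r\ge0$, $\chi_r=1$ if $r\equiv1\pmod k$, $\chi_r=-1$ if $r\equiv0\pmod k$, and $\chi_r=0$ otherwise; for a composition $\mu=(\mu_1,\dots,\mu_t)$, $\chi_\mu=\chi_{\mu_1}\cdots\chi_{\mu_t}$ (empty product $=1$). A Lyndon word is a non-empty finite word $w$ on the alphabet $\{1,2,\dots\}$ that is strictly lexicographically smaller than all its non-trivial cyclic shifts: whenever $w=uv$ with $u,v$ non-empty, $w<vu$. Every word factors uniquely as $w=u_1u_2\cdots u_m$ with $u_1\ge u_2\ge\cdots\ge u_m$ (lexicographically) Lyndon words; $\mathrm{type}(w)$ is the partition whose parts are the lengths of $u_1,\dots,u_m$. If $\mu_j$ is the number of $j$'s in $w$, write $x^{\mathrm{ev}(w)}=x_1^{\mu_1}x_2^{\mu_2}\cdots$. Then $L_\lambda=\sum_{\mathrm{type}(w)=\lambda}x^{\mathrm{ev}(w)}$, a symmetric function. *)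

(* Defs.v *)
From HB Require Import structures.
From mathcomp Require Import all_boot all_order all_fingroup all_algebra.
From mathcomp Require Import finmap multiset.
From mathcomp Require Import boolp classical_sets functions cardinality fsbigop.

Set Implicit Arguments.
Unset Strict Implicit.
Unset Printing Implicit Defensive.

Import Order.TTheory GRing.Theory Num.Theory.

Local Open Scope classical_set_scope.
Local Open Scope ring_scope.

(* Formal power series over rat in x_0, x_1, x_2, ... (the paper's            *)
(* x_1, x_2, ...). A monomial is the multiset of its variable indices, so     *)
(* f m is the coefficient of \prod_i x_i ^+ (m i) in f.                       *)

Notation mon := {mset nat}%mset.

Definition pser := mon -> rat.

Definition splits (m : mon) : set (mon * mon) := [set p | (p.1 `+` p.2)%mset = m].

Definition pser_one : pser := fun m => (m == mset0)%:R.

Definition pser_mul (f g : pser) : pser :=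
  fun m => \sum_(p \in splits m) f p.1 * g p.2.

HB.instance Definition _ := gen_eqMixin pser.
HB.instance Definition _ := gen_choiceMixin pser.

Section Additive.
Implicit Types f g h : pser.

Let add f g : pser := fun m => f m + g m.
Let opp f : pser := fun m => - f m.
Let zero : pser := fun=> 0.
Let scale (a : rat) f : pser := fun m => a * f m.

Fact pser_addA : associative add.
Proof. by move=> f g h; apply/funext => m; exact: addrA. Qed.
Fact pser_addC : commutative add.
Proof. by move=> f g; apply/funext => m; exact: addrC. Qed.
Fact pser_add0 : left_id zero add.
Proof. by move=> f; apply/funext => m; exact: add0r. Qed.
Fact pser_addN : left_inverse zero opp add.
Proof. by move=> f; apply/funext => m; exact: addNr. Qed.

HB.instance Definition _ :=
  GRing.isZmodule.Build pser pser_addA pser_addC pser_add0 pser_addN.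

Fact pser_scaleA a b f : scale a (scale b f) = scale (a * b) f.
Proof. by apply/funext => m; exact: mulrA. Qed.
Fact pser_scale1 : left_id 1 scale.
Proof. by move=> f; apply/funext => m; exact: mul1r. Qed.
Fact pser_scaleDr : right_distributive scale +%R.
Proof. by move=> a f g; apply/funext => m; exact: mulrDr. Qed.
Fact pser_scaleDl f : {morph scale^~ f : a b / a + b}.
Proof. by move=> a b; apply/funext => m; exact: mulrDl. Qed.

HB.instance Definition _ := GRing.Zmodule_isLmodule.Build rat pser
  pser_scaleA pser_scale1 pser_scaleDr pser_scaleDl.
End Additive.

Lemma pserDE (f g : pser) m : (f + g) m = f m + g m. Proof. by []. Qed.
Lemma pserNE (f : pser) m : (- f) m = - f m. Proof. by []. Qed.
Lemma pser0E m : (0 : pser) m = 0. Proof. by []. Qed.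
Lemma pserZE a (f : pser) m : (a *: f) m = a * f m. Proof. by []. Qed.

Lemma pser_sumE I (r : seq I) (P : pred I) (F : I -> pser) m :
  (\sum_(i <- r | P i) F i) m = \sum_(i <- r | P i) F i m.
Proof. exact: (big_morph (fun f : pser => f m)). Qed.

Section Multiplicative.
Implicit Types (f g h : pser) (m : mon).

Lemma finite_submset m : finite_set [set a : mon | (a `<=` m)%mset].
Proof.
pose T := {ffun finsupp m -> 'I_(size (m : seq nat)).+1}.
pose F (u : T) : mon :=
  [mset[tt] x in finsupp m => oapp (fun y => u y : nat) 0%N (insub x)]%mset.
apply: (@sub_finite_set _ _ (F @` [set: T])); last first.
  exact/finite_image/finite_finset.
move=> a /= /msubsetP am.
exists [ffun y => inord (a (val y))] => //.
apply/msetP => x; rewrite /F fsfunE; case: ifPn => xm.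
  rewrite insubT /= ffunE /= inordK// ltnS (leq_trans (am x))//.
  by rewrite -count_mem_mset count_size.
have := am x; rewrite (fsfun_dflt xm) leqn0 => /eqP -> //.
Qed.

Lemma pser_mulE f g m (D : seq mon) :
    uniq D -> (forall a, (a `<=` m)%mset -> a \in D) ->
  pser_mul f g m =
  \sum_(a <- D) \sum_(b <- D) (if (a `+` b)%mset == m then f a * g b else 0).
Proof.
move=> uD mD; rewrite /pser_mul.
have subl a b : (a `+` b)%mset = m -> (a `<=` m)%mset.
  by move=> <-; apply/msubsetP => x; rewrite msetE2 leq_addr.
have subr a b : (a `+` b)%mset = m -> (b `<=` m)%mset.
  by move=> <-; apply/msubsetP => x; rewrite msetE2 leq_addl.
pose r := [seq p <- [seq (a, b) | a <- D, b <- D] | (p.1 `+` p.2)%mset == m].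
have ur : uniq r.
  rewrite filter_uniq//; apply: allpairs_uniq => // -[a b] [c d] _ _ /=.
  by move=> [-> ->].
have rE : splits m = [set` r].
  apply/seteqP; split => [[a b] /= ab|[a b] /=]; last first.
    by rewrite mem_filter => /andP[/eqP].
  rewrite mem_filter /= ab eqxx /=; apply/allpairsP; exists (a, b).
  by split=> //=; apply: mD; [exact: subl ab|exact: subr ab].
rewrite rE -fsbig_seq// big_filter big_mkcond /=.
by rewrite big_allpairs_dep.
Qed.

Let dom (m : mon) : seq mon := fset_set [set a : mon | (a `<=` m)%mset].

Let domP m a : (a \in dom m) = (a `<=` m)%mset.
Proof.
rewrite /dom in_fset_set; last exact: finite_submset.
by apply/idP/idP; rewrite inE.
Qed.

Let dom_uniq m : uniq (dom m). Proof. exact: fset_uniq. Qed.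

Let mulE f g m m' : (m `<=` m')%mset -> pser_mul f g m =
  \sum_(a <- dom m') \sum_(b <- dom m')
     (if (a `+` b)%mset == m then f a * g b else 0).
Proof.
move=> mm'; apply: pser_mulE => // a am; rewrite domP.
exact: msubset_trans am mm'.
Qed.

Fact pser_mulC : commutative pser_mul.
Proof.
move=> f g; apply/funext => m; rewrite !(mulE _ _ (msubset_refl m)).
rewrite exchange_big /=; apply: eq_bigr => a _; apply: eq_bigr => b _.
by rewrite msetDC mulrC.
Qed.

Let subl (a b m : mon) : (a `+` b)%mset = m -> (a `<=` m)%mset.
Proof. by move=> <-; apply/msubsetP => x; rewrite msetE2 leq_addr. Qed.

Let subr (a b m : mon) : (a `+` b)%mset = m -> (b `<=` m)%mset.
Proof. by move=> <-; apply/msubsetP => x; rewrite msetE2 leq_addl. Qed.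

Let mul3E f g h m : pser_mul f (pser_mul g h) m =
  \sum_(a <- dom m) \sum_(b <- dom m) \sum_(c <- dom m)
     (if (a `+` (b `+` c))%mset == m then f a * (g b * h c) else 0).
Proof.
rewrite (mulE _ _ (msubset_refl m)); apply: eq_bigr => a _.
transitivity (\sum_(d <- dom m) \sum_(b <- dom m) \sum_(c <- dom m)
   (if d == (b `+` c)%mset then
      (if (a `+` (b `+` c))%mset == m then f a * (g b * h c) else 0) else 0)).
  rewrite big_seq [RHS]big_seq; apply: eq_bigr => d; rewrite domP => dm.
  rewrite (mulE _ _ dm); case: ifPn => adm; last first.
    rewrite big1 // => b _; rewrite big1 // => c _.
    by case: eqP => // <-; rewrite (negPf adm).
  rewrite mulr_sumr; apply: eq_bigr => b _; rewrite mulr_sumr.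
  apply: eq_bigr => c _; rewrite eq_sym; case: eqP => [<-|_]; last exact: mulr0.
  by rewrite adm.
rewrite exchange_big /=; apply: eq_bigr => b _.
rewrite exchange_big /=; apply: eq_bigr => c _.
case: ifPn => abcm; last by rewrite big1 // => d _; rewrite if_same.
rewrite -big_mkcond /= -big_filter.
have -> : [seq d <- dom m | d == (b `+` c)%mset] = [:: (b `+` c)%mset].
  apply: filter_pred1_uniq => //; rewrite domP.
  by apply: (@subr a); apply/eqP.
by rewrite big_seq1.
Qed.

Fact pser_mulA : associative pser_mul.
Proof.
move=> f g h; rewrite [RHS]pser_mulC; apply/funext => m; rewrite !mul3E.
under eq_bigr => a _ do rewrite exchange_big /=.
rewrite [LHS]exchange_big /=; apply: eq_bigr => c _.
apply: eq_bigr => a _; apply: eq_bigr => b _.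
by rewrite msetDA [(c `+` _)%mset]msetDC mulrA mulrC.
Qed.

Fact pser_mul1 : left_id pser_one pser_mul.
Proof.
move=> f; apply/funext => m; rewrite (mulE _ _ (msubset_refl m)).
rewrite (bigD1_seq (mset0 : mon)) ?domP ?dom_uniq //=; last exact: msub0set.
rewrite (bigD1_seq m) ?domP ?msubset_refl //= mset0D eqxx /pser_one eqxx mul1r.
rewrite big1 => [|b bm]; last by rewrite mset0D (negPf bm).
rewrite addr0 big1 ?addr0 // => a a0; rewrite big1 // => b _.
by rewrite (negPf a0) mul0r if_same.
Qed.

Fact pser_mulDl : left_distributive pser_mul +%R.
Proof.
move=> f g h; apply/funext => m; rewrite pserDE !(mulE _ _ (msubset_refl m)).
rewrite -big_split; apply: eq_bigr => a _; rewrite -big_split.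
apply: eq_bigr => b _ /=; rewrite pserDE mulrDl.
by case: ifP => // _; rewrite addr0.
Qed.

Fact pser_1neq0 : pser_one != 0.
Proof.
apply/eqP => /(congr1 (fun f : pser => f mset0)); rewrite pser0E /pser_one eqxx.
by move/eqP; rewrite oner_eq0.
Qed.

HB.instance Definition _ := GRing.Zmodule_isComNzRing.Build pser
  pser_mulA pser_mulC pser_mul1 pser_mulDl pser_1neq0.

End Multiplicative.

Lemma pserME (f g : pser) m :
  (f * g) m = \sum_(p \in splits m) f p.1 * g p.2.
Proof. by []. Qed.

(* Coefficientwise convergence of the formal infinite sum of the F i.         *)
Definition pser_sum (F : nat -> pser) (S : pser) : Prop :=
  forall m, exists N, forall M, (N <= M)%N -> (\sum_(i < M) F i) m = S m.

(* The formal sum of x^ev(w) over the words w in A; seq_mset w is ev(w). As   *)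
(* for the variables, letters start at 0 instead of 1.                        *)
Definition word_sum (A : set (seq nat)) : pser :=
  fun m => \sum_(w \in [set w | A w /\ seq_mset w = m]) (1 : rat).

Definition is_part (lam : seq nat) : bool := sorted geq lam && (0%N \notin lam).

Definition part_of (n : nat) (lam : seq nat) : bool :=
  is_part lam && (sumn lam == n).

Definition comp_of (n : nat) (mu : seq nat) : bool :=
  (0%N \notin mu) && (sumn mu == n).

Definition sym_h (r : nat) : pser :=
  word_sum [set w | size w = r /\ sorted leq w].

Definition sym_e (r : nat) : pser :=
  word_sum [set w | size w = r /\ sorted ltn w].

Definition prod_h (mu : seq nat) : pser := \prod_(r <- mu) sym_h r.

Definition prod_e (mu : seq nat) : pser := \prod_(r <- mu) sym_e r.

Definition sym_m (lam : seq nat) : pser :=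
  fun m => (perm_eq lam [seq m i | i <- finsupp m])%:R.

(* The bilinear form on symmetric functions for which (h_lam) and (m_lam) are *)
(* dual bases; the default 0 is only taken outside symmetric functions.       *)
Definition hall (f g : pser) : rat :=
  xget 0 [set c | exists (s : seq (seq nat)) (a b : seq nat -> rat),
    [/\ uniq s, all is_part s,
        f = \sum_(lam <- s) a lam *: prod_h lam,
        g = \sum_(lam <- s) b lam *: sym_m lam
      & c = \sum_(lam <- s) a lam * b lam]].

(* In a subset of [n-1], the element i is represented by i.-1 : 'I_n.-1.      *)
Definition ribbon (n : nat) (I : {set 'I_n.-1}) : pser :=
  word_sum [set w | size w = n /\ forall i : 'I_n.-1,
    if i \in I then (nth 0 w i > nth 0 w i.+1)%N
    else (nth 0 w i <= nth 0 w i.+1)%N].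

Definition co (n : nat) (I : {set 'I_n.-1}) : seq nat :=
  pairmap (fun a b => b - a)%N 0%N (rcons [seq (val i).+1 | i <- enum I] n).

Definition gset (k n : nat) : {set {set 'I_n.-1}} :=
  [set I : {set 'I_n.-1} | all (fun p => p < k)%N (co I)]%SET.

Definition gtilde (k n : nat) : pser :=
  if n == 0%N then 1 else \sum_(I in gset k n) ribbon (~: I)%SET.

Definition chi (k r : nat) : rat :=
  if (r == 1 %[mod k])%N then 1 else if (r == 0 %[mod k])%N then -1 else 0.

Definition chi_comp (k : nat) (mu : seq nat) : rat := \prod_(r <- mu) chi k r.

Definition avoids (k n : nat) (pi : 'S_n) : bool :=
  let w := [seq val (pi i) | i <- enum 'I_n] in
  [forall i : 'I_n, (i + k <= n)%N ==> ~~ sorted gtn (take k (drop i w))].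

Definition cycle_type (n : nat) (pi : 'S_n) : seq nat :=
  sort geq (map (fun c : {set 'I_n} => #|c|) (enum (porbits pi))).

Definition word_lt (u v : seq nat) : bool :=
  ((u : seqlexi nat) < (v : seqlexi nat))%O.

Definition word_ge (u v : seq nat) : bool :=
  ((v : seqlexi nat) <= (u : seqlexi nat))%O.

Definition lyndon (w : seq nat) : Prop :=
  w <> [::] /\
  forall u v, u <> [::] -> v <> [::] -> w = u ++ v -> word_lt w (v ++ u).

(* us is the (unique) Lyndon factorization of w.                              *)
Definition word_type (w lam : seq nat) : Prop :=
  exists us : seq (seq nat),
    [/\ w = flatten us, forall u, u \in us -> lyndon u, sorted word_ge us
      & lam = sort geq (map size us)].

Definition sym_L (lam : seq nat) : pser :=
  word_sum [set w | word_type w lam].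

(* The terms e_0, - e_1, e_k, - e_{k+1}, e_{2k}, - e_{2k+1}, ... (e_0 = 1).   *)
Definition alt_e (k i : nat) : pser := (-1) ^+ i *: sym_e (i./2 * k + odd i)%N.

(* Main.v *)
Require Import Defs.
From mathcomp Require Import all_boot all_order all_fingroup all_algebra.
From mathcomp Require Import finmap multiset.
From mathcomp Require Import boolp classical_sets functions cardinality fsbigop.
From mathcomp Require Import zify.

(** Both counts are obtained by pairing a symmetric function f, either h_1^n or
    L_lam, with gtilde_n, and the argument is the same for the two.

    Expanding over descent sets. The series gtilde_n is the sum of the words of
    length n without k consecutive decreasing letters, and a permutation avoids
    the pattern exactly when the word of its values is of this kind (gtildeE,
    avoidsE). Whether a word w is of this kind depends only on its descent set,
    so that the indicator of these words is a combination of the conditions that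
    the descents of w lie in J, for J a subset of [n-1] (moebius_sets). Let l be
    the sorted word that is constant on the blocks cut by J. The condition says
    that w is weakly increasing on each block of l, that is, that the biword
    with rows l and w is sorted (biw).

    The Hall form. The words w with this property sum to a product of complete
    functions h. Its coefficient at the content of l' is symmetric in l and l',
    since transposing a sorted biword is a bijection (biw_count_sym). Hence, for
    f in the span of the h's, pairing f with this product gives the coefficient
    of f at the content of l (hallE), and it remains to compare this coefficient
    with the number of permutations that are increasing on the blocks of l
    (hall_gtilde). For f = h_1^n this is standardization, a special case of the
    transposition. For f = L_lam it is the theorem of Gessel and Reutenauer.

    The Gessel-Reutenauer theorem (gessel_reutenauer). Given the Lyndon factors
    of a rearrangement of l, sort all positions in these factors by the periodic
    words that start there. Passing to the next position of the same factor,
    cyclically, becomes a permutation of the ranks. It is increasing on the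
    blocks of l, its cycles have the lengths of the factors (lyndon_cycles), and
    reading l along the cycles gives the factors back (cycles_read_inj). So
    there are at most as many words of type lam as permutations of cycle type
    lam. Summed over lam, these inequalities become an equality, by
    standardization and by the existence of the Lyndon factorization, so each of
    them is an equality.

    Membership of L_lam in the span of the h's. Renaming the letters turns
    primitive necklaces into primitive necklaces, so L_lam is symmetric
    (sym_L_sym); and every symmetric homogeneous series is a combination of
    products of power sums, by triangularity, hence of products of h's, by the
    Newton identities (symmetric_hspan).

    The expansion of gtilde_n. Peeling a decreasing prefix off a word gives
    gtilde_n = sum over r >= 1 of chi_r e_r gtilde_(n-r) (avoidw_rec,
    gtilde_rec); iterating this recurrence gives the sum over compositions, and
    summing it over n gives the generating function. *)

Set Implicit Arguments.
Unset Strict Implicit.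
Unset Printing Implicit Defensive.

Import Order.TTheory GRing.Theory Num.Theory.

Local Open Scope classical_set_scope.
Local Open Scope ring_scope.

(** * Word-weighted series *)

Lemma natr_andb (a b : bool) : (a && b)%:R = a%:R * b%:R :> rat.
Proof. by case: a b => -[]; rewrite ?mulr1 ?mul0r ?mulr0. Qed.

Lemma sum_natr_count (T : eqType) (P : pred T) (s : seq T) :
  \sum_(w <- s) (P w)%:R = (count P s)%:R :> rat.
Proof. by elim: s => [|w s IH]; rewrite ?big_nil // big_cons IH natrD. Qed.

Definition wsum (F : seq nat -> rat) : pser :=
  fun m => \sum_(w <- permutations m) F w.

Lemma eq_wsum_mem F G (m : mon) : (forall w, perm_eq w m -> F w = G w) ->
  wsum F m = wsum G m.
Proof.
move=> FG; rewrite /wsum !big_seq; apply: eq_bigr => w.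
by rewrite mem_permutations => /FG.
Qed.

Lemma eq_wsum F G : F =1 G -> wsum F = wsum G.
Proof.
by move=> FG; apply/funext => m; apply: eq_wsum_mem => w _; apply: FG.
Qed.

Lemma wsum_seq F s : wsum F (seq_mset s) = \sum_(w <- permutations s) F w.
Proof. exact/perm_big/perm_permutations/perm_eq_seq_mset. Qed.

Lemma wsumZ a F : a *: wsum F = wsum (fun w => a * F w).
Proof. by apply/funext => m; rewrite pserZE /wsum mulr_sumr. Qed.

Lemma wsum_sum I (r : seq I) (P : pred I) (F : I -> seq nat -> rat) :
  \sum_(i <- r | P i) wsum (F i) = wsum (fun w => \sum_(i <- r | P i) F i w).
Proof. by apply/funext => m; rewrite pser_sumE /wsum exchange_big. Qed.

Lemma word_sumE A : word_sum A = wsum (fun w => `[< A w >]%:R).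
Proof.
apply/funext => m; rewrite /word_sum /wsum.
set s := [seq w <- permutations m | `[< A w >]].
have -> : [set w | A w /\ seq_mset w = m] = [set` s].
  apply/seteqP; split => w /=.
    move=> [Aw wm]; rewrite mem_filter asboolT // mem_permutations -wm.
    by rewrite perm_sym perm_eq_seq_mset.
  rewrite mem_filter mem_permutations => /andP[/asboolP Aw wm].
  by split=> //; rewrite -(seq_mset_id m); apply/eq_seq_msetP.
rewrite -fsbig_seq ?filter_uniq ?permutations_uniq // /s.
rewrite big_filter big_mkcond /=.
by apply: eq_bigr => w _; case: asboolP.
Qed.

Lemma wsum1 : wsum (fun w => (w == [::])%:R) = 1.
Proof.
have sumE (s : seq nat) :
    \sum_(w <- permutations s) (w == [::])%:R = (s == [::])%:R :> rat.
  case: (eqVneq s [::]) => [->|s0]; first by rewrite big_seq1 eqxx.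
  rewrite big_seq big1 // => w; rewrite mem_permutations => ws.
  case: eqP => // w0; move: ws; rewrite w0 => /perm_size /esym /eqP.
  by rewrite size_eq0 (negPf s0).
apply/funext => m; rewrite [RHS](_ : _ = (m == mset0)%:R) // /wsum sumE.
congr (_%:R); congr nat_of_bool; apply/eqP/eqP => [m0|->].
  rewrite -(seq_mset_id m : _ = m) m0.
  by apply/msetP => x; rewrite mset_seqE mset0E.
exact: (enum_mset0 (K := nat)).
Qed.

Lemma seq_msetD (s t : seq nat) :
  (seq_mset s `+` seq_mset t)%mset = seq_mset (s ++ t).
Proof. by apply/msetP => x; rewrite msetE2 !mset_seqE count_cat. Qed.

(** Letting the letters commute is a ring morphism from the series in
    non-commuting letters, where weights convolve along concatenation. *)
Lemma wsumM F G : wsum F * wsum G =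
  wsum (fun w => \sum_(0 <= i < (size w).+1) F (take i w) * G (drop i w)).
Proof.
apply/funext => m.
pose D : seq mon := fset_set [set a : mon | (a `<=` m)%mset].
have DP a : (a \in D) = (a `<=` m)%mset.
  rewrite /D in_fset_set; last exact: finite_submset.
  by apply/idP/idP; rewrite inE.
have uD : uniq D by exact: fset_uniq.
rewrite [LHS](_ : _ = pser_mul (wsum F) (wsum G) m) //.
rewrite (@pser_mulE _ _ _ D) //; last by move=> a; rewrite DP.
have [N NE] : exists N, N = (size m).+1 by eexists.
pose X := [seq (take i w, drop i w) | w <- permutations m, i <- iota 0 N].
have uX : uniq X.
  apply: allpairs_uniq; rewrite ?permutations_uniq ?iota_uniq // =>
    -[w i] [w' i'].
  move=> /allpairsP[[a b] /= [+ + [-> ->]]].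
  rewrite mem_permutations mem_iota => /perm_size sa ib.
  move=> /allpairsP[[a' b'] /= [+ + [-> ->]]].
  rewrite mem_permutations mem_iota => /perm_size sa' ib'.
  move=> [tt dd].
  have aa : a = a' by rewrite -(cat_take_drop b a) tt dd cat_take_drop.
  rewrite aa; congr (_, _); move: tt; rewrite aa => /(congr1 size).
  rewrite !size_take sa'; move: ib ib'; rewrite NE; set sm := size _.
  clear; case: ifP; case: ifP; lia.
have XP u v : ((u, v) \in X) = perm_eq (u ++ v) m.
  apply/allpairsP/idP => [[[w i] /= [+ _ [-> ->]]]|uv].
    by rewrite mem_permutations cat_take_drop.
  exists (u ++ v, size u); rewrite /= take_size_cat // drop_size_cat //.
  rewrite mem_permutations; split=> //; rewrite mem_iota.
  by move/perm_size: uv; rewrite size_cat NE leq0n add0n ltnS => <-;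
    exact: leq_addr.
transitivity (\sum_(p <- X) F p.1 * G p.2); last first.
  rewrite big_allpairs_dep /wsum !big_seq; apply: eq_bigr => w.
  by rewrite mem_permutations NE /index_iota subn0 => /perm_size ->.
transitivity (\sum_(p <- X) \sum_(a <- D) \sum_(b <- D)
   if (seq_mset p.1 == a) && (seq_mset p.2 == b) then F p.1 * G p.2 else 0);
  last first.
  rewrite !big_seq; apply: eq_bigr => -[u v]; rewrite XP => uv /=.
  have uvm : (seq_mset u `+` seq_mset v)%mset = m.
    by rewrite seq_msetD -(seq_mset_id m); apply/eq_seq_msetP.
  have uD' : seq_mset u \in D.
    by rewrite DP -uvm; apply/msubsetP => x; rewrite msetE2 leq_addr.
  have vD' : seq_mset v \in D.
    by rewrite DP -uvm; apply/msubsetP => x; rewrite msetE2 leq_addl.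
  rewrite (bigD1_seq (seq_mset u)) //= [X in _ + X]big1 ?addr0.
    rewrite (bigD1_seq (seq_mset v)) //= !eqxx /= big1 ?addr0 // => b.
    by rewrite eq_sym => /negPf ->.
  move=> a; rewrite eq_sym => /negPf ->; rewrite big1 // => b _.
rewrite [RHS]exchange_big /=; apply: eq_bigr => a _.
rewrite [RHS]exchange_big /=; apply: eq_bigr => b _.
rewrite -big_mkcond /= -big_filter.
case: ifPn => abm; last first.
  rewrite big_filter big_seq_cond big1 // => -[u v] /=.
  rewrite XP => /andP[uvm /andP[/eqP au /eqP bv]]; case/negP: abm.
  by rewrite -au -bv seq_msetD -[m]seq_mset_id; apply/eqP/eq_seq_msetP.
rewrite /wsum big_distrlr /=.
rewrite -(big_allpairs (F := fun p : seq nat * seq nat => F p.1 * G p.2)).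
apply: perm_big; apply: uniq_perm.
- by apply: allpairs_uniq;
    rewrite ?permutations_uniq // => -[? ?] [? ?] _ _ [-> ->].
- exact: filter_uniq.
have pE (u : seq nat) (c : mon) : perm_eq u c = (seq_mset u == c).
  by rewrite -{2}(seq_mset_id c); apply/eq_seq_msetP/eqP.
move=> [u v]; rewrite mem_filter XP /=.
apply/allpairsP/idP => [[[u' v'] /= [+ + [-> ->]]]|].
  rewrite !mem_permutations !pE -seq_msetD => /eqP -> /eqP ->.
  by rewrite !eqxx abm.
move=> /andP[/andP[ua vb] _]; exists (u, v);
  rewrite !mem_permutations !pE ua vb.
by split.
Qed.

Lemma wsum_split r (P Q : pred (seq nat)) :
  wsum (fun w => ((size w == r) && P w)%:R) * wsum (fun w => (Q w)%:R) =
  wsum (fun w => [&& (r <= size w)%N, P (take r w) & Q (drop r w)]%:R).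
Proof.
rewrite wsumM; apply: eq_wsum => w.
case: (leqP r (size w)) => cw /=; last first.
  rewrite big_nat big1 // => j jw; case: eqP => [|_]; last by rewrite mul0r.
  by rewrite size_takel; lia.
rewrite (bigD1_seq r) ?mem_index_iota ?iota_uniq //=.
rewrite size_takel // eqxx big1_seq ?addr0; first by rewrite /= natr_andb.
move=> j /andP[jc]; rewrite mem_index_iota ltnS => jw.
by rewrite size_takel // (negPf jc) mul0r.
Qed.

Lemma pser_scaleAl a (f g : pser) : a *: (f * g) = (a *: f) * g.
Proof.
apply/funext => m; rewrite pserZE.
pose D : seq mon := fset_set [set a : mon | (a `<=` m)%mset].
have DP b : (b `<=` m)%mset -> b \in D.
  by move=> bm; rewrite /D in_fset_set ?inE //; exact: finite_submset.
have uD : uniq D by exact: fset_uniq.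
rewrite [(f * g) m](@pser_mulE _ _ _ D) // [RHS](@pser_mulE _ _ _ D) //.
rewrite mulr_sumr; apply: eq_bigr => b _; rewrite mulr_sumr.
by apply: eq_bigr => c _; case: ifP => _; rewrite ?mulr0 // pserZE mulrA.
Qed.

Lemma pser_scaleAr a (f g : pser) : a *: (f * g) = f * (a *: g).
Proof. by rewrite mulrC pser_scaleAl mulrC. Qed.

(** * Words without a long decreasing factor *)

Definition avoidw (k : nat) (w : seq nat) : bool :=
  all (fun i => ~~ sorted gtn (take k (drop i w))) (iota 0 ((size w).+1 - k)).

Definition decreasing_on (w : seq nat) (a b : nat) : Prop :=
  forall j, (a <= j)%N -> (j.+1 < b)%N -> (nth 0 w j.+1 < nth 0 w j)%N.

Lemma avoidwP k w : reflect
  (forall i, (i + k <= size w)%N -> ~~ sorted gtn (take k (drop i w)))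
  (avoidw k w).
Proof.
apply: (iffP allP) => H i; first by move=> ik; apply: H; rewrite mem_iota; lia.
by rewrite mem_iota => ik; apply: H; lia.
Qed.

Lemma sorted_factorP w a r : (a + r <= size w)%N ->
  reflect (decreasing_on w a (a + r)) (sorted gtn (take r (drop a w))).
Proof.
move=> arw; apply: (iffP (sortedP 0%N)) => H j.
  move=> aj jr; have := H (j - a)%N.
  rewrite size_take size_drop !nth_take ?nth_drop; try lia.
  by rewrite addnS subnKC //; apply; case: ifP; lia.
rewrite size_take size_drop => jr.
have {}jr : (j.+1 < r)%N by move: jr; case: ifP; lia.
rewrite !nth_take ?nth_drop; try lia.
by rewrite addnS; apply: H; lia.
Qed.

Lemma chi_window k d : (2 <= k)%N ->
  \sum_(1 <= r < d.+1) chi k r = (d %% k != 0)%N%:R.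
Proof.
move=> k2; elim: d => [|d IH]; first by rewrite big_geq ?mod0n.
rewrite big_nat_recr //= IH /chi mod0n (modn_small k2).
have [e|e] := eqVneq (d.+1 %% k)%N 0%N.
  rewrite /= e /=.
  have -> : (d %% k != 0)%N by apply/eqP => e'; move: e;
    rewrite -addn1 -modnDml e' modn_small.
  by rewrite subrr.
case: (eqVneq (d.+1 %% k)%N 1%N) => [e1|e1].
  have -> : (d %% k == 0)%N; last by rewrite add0r.
  have dk : (d %% k < k)%N by rewrite ltn_mod; lia.
  case: (leqP k (d %% k)%N.+1) => h.
    have h1 : ((d %% k)%N.+1 = k) by lia.
    by move: e; rewrite -addn1 -modnDml addn1 h1 modnn.
  by move: e1; rewrite -addn1 -modnDml addn1 modn_small // => -[->].
have -> : (d %% k != 0)%N; last by rewrite addr0.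
by apply/eqP => e'; move: e1; rewrite -addn1 -modnDml e' modn_small // eqxx.
Qed.

(** If the maximal decreasing prefix of w has length d, then peeling off r <= d
    letters leaves an avoiding word exactly when d - r < k and the rest of w
    after that prefix is avoiding. So the sum runs over a window of min(d, k)
    consecutive values of chi: it is 1 when d < k and 0 when d >= k. *)
Lemma avoidw_rec k w : (2 <= k)%N -> (0 < size w)%N ->
  \sum_(1 <= r < (size w).+1)
     chi k r * ((sorted gtn (take r w))%:R * (avoidw k (drop r w))%:R)
  = (avoidw k w)%:R.
Proof.
move=> k2 w0.
have s1 : (1 <= size w)%N && sorted gtn (take 1 w).
  by case: w w0 => //= a l _; rewrite take0.
have ex : exists r, (r <= size w)%N && sorted gtn (take r w) by exists 1%N.
have ub r : (r <= size w)%N && sorted gtn (take r w) -> (r <= size w)%N.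
  by case/andP.
case: (ex_maxnP ex ub) => d /andP[dw sd] dmax.
have d1 : (1 <= d)%N by apply: dmax.
have sE r : (r <= size w)%N -> sorted gtn (take r w) = (r <= d)%N.
  move=> rw; apply/idP/idP => [sr|rd]; first by apply: dmax; rewrite rw.
  by rewrite -(take_takel w rd); apply: take_sorted.
have dd : decreasing_on w 0 d.
  by apply/(@sorted_factorP w 0 d dw); rewrite drop0.
have ndd : (d < size w)%N -> ~~ (nth 0%N w d < nth 0%N w d.-1)%N.
  move=> dw'; apply/negP => lt; have := sE d.+1 dw'; rewrite ltnn => /negP;
    apply.
  rewrite -[w in take _ w]drop0; apply/(@sorted_factorP w 0 d.+1 dw') => j _ jd.
  case: (eqVneq j.+1 d) => [e|e]; last by apply: dd; lia.
  by move: lt; rewrite -e.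
have aE r : (r <= d)%N ->
    avoidw k (drop r w) = (d < r + k)%N && avoidw k (drop d w).
  move=> rd; apply/avoidwP/andP => [av|[drk /avoidwP av] i].
    split.
      rewrite ltnNge; apply/negP => le.
      have := av 0%N; rewrite size_drop drop_drop add0n =>
        /(_ ltac:(lia)) /negP; apply.
      by apply/sorted_factorP; [lia|move=> j rj jk; apply: dd; lia].
    apply/avoidwP => i; rewrite size_drop drop_drop => ik.
    have := av (i + (d - r))%N; rewrite size_drop drop_drop.
    rewrite (_ : i + (d - r) + r = i + d)%N; last by lia.
    by apply; lia.
  rewrite size_drop drop_drop => ik.
  case: (leqP d (i + r)) => dir.
    have := av (i + r - d)%N; rewrite size_drop drop_drop subnK //; by apply;
      lia.
  apply/negP => /sorted_factorP => /(_ ltac:(lia)) dw'.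
  have : ~~ (nth 0%N w d < nth 0%N w d.-1)%N by apply: ndd; lia.
  by move/negP; apply; have := dw' d.-1; rewrite prednK //; apply; lia.
have aE0 := aE 0%N (leq0n d); rewrite drop0 add0n in aE0.
rewrite aE0 (big_cat_nat (n := d.+1)) //=.
rewrite [X in _ + X]big_nat_cond [X in _ + X]big1.
  rewrite addr0; transitivity (\sum_(1 <= r < d.+1)
    (chi k r * (d < r + k)%N%:R * (avoidw k (drop d w))%:R)).
    rewrite !big_nat; apply: eq_bigr => r /andP[_ rd].
    rewrite ltnS in rd; rewrite (sE _ (leq_trans rd dw)) rd (aE _ rd).
    by rewrite mul1r natr_andb mulrA.
  rewrite -mulr_suml natr_andb; congr (_ * _).
  case: (ltnP d k) => dk.
    transitivity (\sum_(1 <= r < d.+1) chi k r).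
      rewrite !big_nat; apply: eq_bigr => r rd.
      by have -> : (d < r + k)%N by [lia]; rewrite mulr1.
    rewrite chi_window // modn_small //; case: (d) d1 => //.
  rewrite (big_cat_nat (n := (d - k).+1)) /=; [|lia|lia].
  rewrite [X in X + _]big_nat_cond [X in X + _]big1 ?add0r; last first.
    by move=> r rd; rewrite (_ : (_ < _)%N = false) ?mulr0 //; lia.
  have dE : (d %% k = (d - k) %% k)%N by rewrite -{1}(subnK dk) modnDr.
  have := chi_window d k2; rewrite dE (big_cat_nat (n := (d - k).+1)) /=;
    [|lia|lia].
  rewrite chi_window // => e.
  have {}e : \sum_((d - k).+1 <= r < d.+1) chi k r = 0.
    by apply: (addrI ((d - k) %% k != 0)%N%:R); rewrite e addr0.
  rewrite -[RHS]e !big_nat; apply: eq_bigr => r rd.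
  by have -> : (d < r + k)%N by [lia]; rewrite mulr1.
move=> r; rewrite andbT => rd; rewrite sE; last by lia.
by rewrite (_ : (r <= d)%N = false) ?mul0r ?mulr0 //; lia.
Qed.

(** * The series gtilde and its expansion into elementary symmetric functions *)

(** Two consecutive entries differ by at least k exactly when k - 1 consecutive
    integers fit strictly between them. *)
Lemma small_gaps k l a n : path ltn a (rcons l n) ->
  reflect (forall i, (a <= i)%N -> (i + k <= n)%N ->
             exists j, [/\ j \in l, (i < j)%N & (j < i + k)%N])
    (all (fun p => p < k)%N (pairmap (fun a b => b - a)%N a (rcons l n))).
Proof.
elim: l a => [|b l IH] a /=.
  rewrite !andbT => an; apply: (iffP idP) => [nak i ai ik|]; first by lia.
  move=> H; rewrite ltnNge; apply/negP => kna.
  by have [|j [//]] := H a (leqnn a); lia.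
move=> /andP[ab pb]; have bn : (b < n)%N.
  have := pb; rewrite (path_sortedE ltn_trans) => /andP[/allP + _].
  by move=> /(_ n); rewrite mem_rcons mem_head; apply.
apply: (iffP andP) => [[bak /(IH _ pb) H] i ai ik|H].
  case: (leqP b i) => bi.
    by have [j [jl ij jk]] := H i bi ik; exists j; rewrite inE jl orbT.
  by exists b; rewrite mem_head; split=> //; lia.
split; last first.
  apply/(IH _ pb) => i bi ik; have [|j [jl ij jk]] := H i _ ik; first by lia.
  exists j; split=> //; move: jl; rewrite inE => /orP[/eqP jb|//]; lia.
rewrite ltnNge; apply/negP => kab.
have [||j [jl aj jk]] := H a; [by []|by lia|].
move: jl; rewrite inE => /orP[/eqP jb|jl]; first by lia.
have := pb; rewrite (path_sortedE ltn_trans) => /andP[/allP + _].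
by move=> /(_ j); rewrite mem_rcons inE jl orbT => /(_ isT); lia.
Qed.

Lemma path_enum_ord n (I : {set 'I_n.-1}) : (0 < n)%N ->
  path ltn 0 (rcons [seq (val i).+1 | i <- enum I] n).
Proof.
move=> n0; rewrite (path_sortedE ltn_trans) all_rcons n0 /=; apply/andP; split.
  by apply/allP => x /mapP[i _ ->].
rewrite -cats1 sorted_pairwise; last exact: ltn_trans.
rewrite pairwise_cat /= andbT; apply/andP; split.
  apply/allrelP => x y /mapP[i _ ->]; rewrite inE => /eqP ->.
  by have := ltn_ord i; rewrite /=; lia.
rewrite -sorted_pairwise; last exact: ltn_trans.
have -> : [seq (val i).+1 | i <- enum I] = map succn (map val (enum I)).
  by rewrite -map_comp.
rewrite sorted_map /= (@eq_sorted _ _ ltn) //.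
have -> : enum I = [seq i <- enum 'I_n.-1 | i \in I].
  by rewrite enumT; apply: eq_filter.
rewrite sorted_map sorted_filter //; first by move=> x y z /=; apply: ltn_trans.
by rewrite -[sorted _ _]sorted_map val_enum_ord iota_ltn_sorted.
Qed.

Lemma gsetP k n (I : {set 'I_n.-1}) : (0 < n)%N ->
  reflect (forall i, (i + k <= n)%N ->
             exists j : 'I_n.-1, [/\ j \in I, (i <= j)%N & (j.+1 < i + k)%N])
    (I \in gset k n).
Proof.
move=> n0; rewrite inE /co; apply: (iffP (small_gaps k (path_enum_ord I n0))).
  move=> H i ik; have [_ [/mapP[j jI ->] /= ij jk]] := H i isT ik.
  by exists j; rewrite mem_enum in jI.
move=> H i _ ik; have [j [jI ij jk]] := H i ik.
by exists j.+1; split=> //; apply/mapP; exists j; rewrite ?mem_enum.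
Qed.

Definition descents n (w : seq nat) : {set 'I_n.-1} :=
  [set i : 'I_n.-1 | (nth 0 w i.+1 < nth 0 w i)%N]%SET.

Lemma gset_descents k w : (0 < size w)%N ->
  ((~: descents (size w) w)%SET \in gset k (size w)) = avoidw k w.
Proof.
move=> w0; apply/(gsetP _ _ w0)/avoidwP => H i ik.
  apply/negP => /(sorted_factorP ik) d.
  have [j []] := H i ik; rewrite !inE => /negP nd ij jk.
  by apply: nd; apply: d.
apply: contrapT => nex; have /negP := H i ik; apply.
apply/(sorted_factorP ik) => j ij jk.
apply: contrapT => /negP nd; apply: nex.
have jn : (j < (size w).-1)%N by lia.
by exists (Ordinal jn); rewrite !inE.
Qed.

Lemma ribbonE n (I : {set 'I_n.-1}) :
  ribbon I = wsum (fun w => ((size w == n) && (descents n w == I))%:R).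
Proof.
rewrite /ribbon word_sumE; apply: eq_wsum => w; congr (nat_of_bool _)%:R.
apply/asboolP/andP => [[sw H]|[/eqP sw /eqP <-]].
  split; first exact/eqP.
  apply/eqP/setP => i; rewrite inE; have := H i.
  by case: ifP => // _; rewrite leqNgt => /negPf.
by split=> // i; rewrite inE; case: ltnP.
Qed.

(** The runs of a word between its weak ascents have lengths co(~: Des w). *)
Lemma gtildeE k n : (1 < k)%N ->
  gtilde k n = wsum (fun w => ((size w == n) && avoidw k w)%:R).
Proof.
move=> k1; rewrite /gtilde; case: (eqVneq n 0%N) => [->|n0].
  rewrite -wsum1; apply: eq_wsum => w; rewrite size_eq0.
  case: (eqVneq w [::]) => [->|//]; rewrite /=.
  suff -> : avoidw k [::] by [].
  by apply/avoidwP => i; rewrite /=; lia.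
under eq_bigr do rewrite ribbonE.
rewrite wsum_sum; apply: eq_wsum => w.
case: (eqVneq (size w) n) => [sw|]; last by rewrite big1.
rewrite -sw in n0 *; rewrite /= -gset_descents ?lt0n //.
have dE (I : {set 'I_(size w).-1}) : (descents (size w) w == ~: I)%SET =
    (I == ~: descents (size w) w)%SET.
  by rewrite -(inj_eq (@finset.setC_inj _)) finset.setCK eq_sym.
case: (boolP (_ \in gset _ _)) => H.
  rewrite (bigD1 _ H) /= dE eqxx big1 ?addr0 // => I /andP[_].
  by rewrite dE => /negPf ->.
rewrite big1 // => I IG; rewrite dE; case: eqP => // eI.
by rewrite -eI IG in H.
Qed.

Lemma wsum_rev F : wsum F = wsum (F \o rev).
Proof.
apply/funext => m; rewrite /wsum -(big_map rev xpredT F).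
apply: perm_big; apply: uniq_perm; rewrite ?permutations_uniq //.
  by rewrite map_inj_uniq ?permutations_uniq //; apply: (can_inj revK).
move=> w; rewrite mem_permutations; apply/idP/mapP => [wm|[v]].
  by exists (rev w); rewrite ?revK // mem_permutations perm_rev.
by rewrite mem_permutations => vm ->; rewrite perm_rev.
Qed.

Lemma sym_eE r :
  sym_e r = wsum (fun w => ((size w == r) && sorted gtn w)%:R).
Proof.
rewrite /sym_e word_sumE wsum_rev; apply: eq_wsum => w /=.
congr (nat_of_bool _)%:R; rewrite -[sorted gtn w]rev_sorted -[w in RHS]revK.
rewrite size_rev revK.
by apply/asboolP/andP => -[/= /eqP ? ?].
Qed.

Lemma sym_e0 : sym_e 0 = 1.
Proof.
rewrite sym_eE -wsum1; apply: eq_wsum => w; rewrite size_eq0.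
by case: eqP => // ->.
Qed.

Lemma gtilde_rec k n : (1 < k)%N -> (0 < n)%N ->
  gtilde k n = \sum_(1 <= r < n.+1) chi k r *: (sym_e r * gtilde k (n - r)).
Proof.
move=> k1 n0; rewrite gtildeE //.
under eq_big_nat => r _ do rewrite sym_eE gtildeE // wsum_split wsumZ.
rewrite wsum_sum; apply: eq_wsum => w.
case: (eqVneq (size w) n) => [sw|sw] /=.
  rewrite -avoidw_rec ?sw // !big_nat; apply: eq_bigr => r /andP[_ rn].
  by rewrite size_drop sw eqxx -ltnS rn /= natr_andb.
rewrite big_nat big1 // => r rn; case: leqP => // rw; rewrite ?mulr0 //.
by rewrite size_drop [_ == _](_ : _ = false) ?andbF ?mulr0 //; lia.
Qed.

(** The first argument bounds the recursion: the list is complete when it is at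
    least n. *)
Fixpoint compositions (fuel n : nat) : seq (seq nat) :=
  if n == 0%N then [:: [::]] else
  if fuel is f.+1 then
    [seq r :: mu | r <- iota 1 n, mu <- compositions f (n - r)]
  else [::].

Lemma compositionsS f n : (0 < n)%N -> compositions f.+1 n =
  [seq r :: mu | r <- iota 1 n, mu <- compositions f (n - r)].
Proof. by case: n. Qed.

Lemma compositions0 f : compositions f 0 = [:: [::]].
Proof. by case: f. Qed.

Lemma mem_compositions f n mu : (n <= f)%N ->
  (mu \in compositions f n) = comp_of n mu.
Proof.
rewrite /comp_of; have c0 g (nu : seq nat) : (nu \in compositions g 0) =
    (0%N \notin nu) && (sumn nu == 0%N).
  by rewrite compositions0 inE; case: nu => [|[|a] l] //=; rewrite andbF.
elim: f n mu => [|f IH] n mu nf; first by move: nf; rewrite leqn0 => /eqP ->.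
case: (posnP n) => [-> //|n0]; rewrite compositionsS //.
apply/allpairsPdep/idP => [[r [mu' [rn mu'c ->]]]|].
  move: rn mu'c; rewrite mem_iota => rn; rewrite IH; last by lia.
  move=> /andP[m0 /eqP sm]; rewrite inE negb_or m0 /= sm; lia.
case: mu => [|a l]; first by move=> /andP[_ /eqP /=]; lia.
rewrite inE negb_or => /andP[/andP[a0 l0] /= /eqP sm].
exists a, l; rewrite mem_iota IH ?l0 /=; last by lia.
by split=> //; lia.
Qed.

Lemma compositions_uniq f n : uniq (compositions f n).
Proof.
elim: f n => [|f IH] [|n] //.
rewrite compositionsS //; move: n.+1 => {}n.
apply: allpairs_uniq_dep => [|r _|[r mu] [r' mu'] _ _ [-> ->] //].
  exact: iota_uniq.
exact: IH.
Qed.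

Lemma big_compositions f n (G : seq nat -> pser) : (0 < n)%N ->
  \sum_(mu <- compositions f.+1 n) G mu =
  \sum_(1 <= r < n.+1) \sum_(mu <- compositions f (n - r)) G (r :: mu).
Proof.
move=> n0; rewrite compositionsS // /index_iota subSS subn0.
exact: big_allpairs_dep.
Qed.

Lemma gtilde_compositions k n : (1 < k)%N -> gtilde k n
  = \sum_(mu \in [set mu | comp_of n mu]) chi_comp k mu *: prod_e mu.
Proof.
move=> k1.
have -> : [set mu | comp_of n mu] = [set` compositions n n].
  by apply/seteqP; split=> mu /=; rewrite mem_compositions.
rewrite -fsbig_seq ?compositions_uniq //.
suff H f : (n <= f)%N -> gtilde k n =
    \sum_(mu <- compositions f n) chi_comp k mu *: prod_e mu by exact: H.
elim: f n => [|f IH] n nf.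
  have -> : n = 0%N by lia.
  by rewrite big_seq1 /gtilde eqxx /chi_comp /prod_e !big_nil scale1r.
case: (posnP n) => [->|n0].
  by rewrite big_seq1 /gtilde eqxx /chi_comp /prod_e !big_nil scale1r.
rewrite big_compositions // gtilde_rec // !big_nat; apply: eq_bigr => r rn.
rewrite IH; last by lia.
rewrite mulr_sumr scaler_sumr; apply: eq_bigr => mu _.
by rewrite /chi_comp /prod_e !big_cons -pser_scaleAr scalerA.
Qed.

Lemma sym_e_homog r (m : mon) : size (m : seq nat) != r -> sym_e r m = 0.
Proof.
move=> sm; rewrite sym_eE /wsum big_seq big1 // => w.
rewrite mem_permutations => /perm_size sw.
by rewrite sw (negPf sm).
Qed.

Lemma gtilde_homog k n (m : mon) : (1 < k)%N -> size (m : seq nat) != n ->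
  gtilde k n m = 0.
Proof.
move=> k1 sm; rewrite gtildeE // /wsum big_seq big1 // => w.
rewrite mem_permutations => /perm_size sw.
by rewrite sw (negPf sm).
Qed.

(** * The generating function *)

Notation degree m := (size (enum_mset m)).

Lemma pser_sum_graded (F : nat -> pser) :
  (forall r (m : mon), degree m != r -> F r m = 0) ->
  pser_sum F (fun m => F (degree m) m).
Proof.
move=> homF m; exists (degree m).+1 => M mM; rewrite pser_sumE.
rewrite (bigD1 (Ordinal mM)) //= big1 ?addr0 // => i im.
by apply: homF; apply: contra im => /eqP e; apply/eqP/val_inj.
Qed.

Lemma altE k s M : (1 < k)%N -> (s.+1.*2 <= M)%N ->
  \sum_(i < M) (-1) ^+ i * (i./2 * k + odd i == s)%N%:R = - chi k s :> rat.
Proof.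
(* i is recovered from s = i./2 * k + odd i by Euclidean division by k. *)
move=> k1 sM; set i0 := (s %% k + (s %/ k).*2)%N.
have kp : (0 < k)%N by lia.
have dE i : (i./2 * k + odd i == s)%N = (s %% k < 2)%N && (i == i0).
  apply/eqP/andP => [e|[s2 /eqP ->]].
    rewrite /i0 -e modnMDl divnMDl // modn_small; last by case: (odd i).
    rewrite divn_small; last by case: (odd i).
    by rewrite addn0 odd_double_half; case: (odd i).
  rewrite /i0 [RHS](divn_eq s k);
    move: (s %/ k)%N (s %% k)%N s2 => q [|[|r]] // _.
    by rewrite add0n doubleK odd_double.
  by rewrite add1n /= uphalf_double odd_double.
under eq_bigr do rewrite dE.
have i0M : (i0 < M)%N.
  apply: leq_trans sM; rewrite doubleS ltnS /i0.
  have := divn_eq s k; have : (s %/ k * 2 <= s %/ k * k)%N by rewrite leq_mul2l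
    k1 orbT.
  by rewrite -!muln2; lia.
rewrite (bigD1 (Ordinal i0M)) //= big1 ?addr0 => [|i]; last first.
  by rewrite -val_eqE /= => /negPf ->; rewrite andbF mulr0.
rewrite eqxx andbT /chi mod0n (modn_small k1) /i0.
case: (s %% k)%N => [|[|x]] /=.
- by rewrite add0n -signr_odd odd_double mulr1 opprK.
- by rewrite add1n -signr_odd /= odd_double mulr1.
- by rewrite mulr0 oppr0.
Qed.

Lemma gtilde_series k : (1 < k)%N -> exists Sg Se : pser,
  [/\ pser_sum (gtilde k) Sg,
      pser_sum (fun r => chi k r.+1 *: sym_e r.+1) Se,
      Sg * (1 - Se) = 1
    & pser_sum (alt_e k) (1 - Se)].
Proof.
move=> k1.
pose Sg : pser := fun m => gtilde k (degree m) m.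
(* E is 1 - Se: its constant term is - chi 0 = 1. *)
pose E : pser := fun m => - (chi k (degree m) * sym_e (degree m) m).
have chi0 : chi k 0 = -1 by rewrite /chi mod0n (modn_small k1).
have E1 (m : mon) : (1 - E) m =
    if degree m == 0%N then 0 else chi k (degree m) * sym_e (degree m) m.
  rewrite pserDE pserNE /E opprK; case: eqP => [e|/eqP e].
    rewrite e chi0 sym_e0 mulN1r addrN //.
  by rewrite -sym_e0 (sym_e_homog e) add0r.
exists Sg, (1 - E); split.
- apply: pser_sum_graded => r m; exact: gtilde_homog.
- move=> m; exists (degree m) => M mM; rewrite E1 pser_sumE.
  case: eqP => [e|/eqP e].
    by rewrite big1 // => i _; rewrite pserZE sym_e_homog ?mulr0 // e.
  have im : ((degree m).-1 < M)%N by lia.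
  rewrite (bigD1 (Ordinal im)) //= prednK ?lt0n // pserZE big1 ?addr0 // =>
    i ie.
  rewrite pserZE sym_e_homog ?mulr0 //; apply: contra ie => /eqP e'.
  by apply/eqP/val_inj; rewrite /= e'.
- rewrite opprB addrC subrK.
  have -> : Sg = wsum (fun w => (avoidw k w)%:R).
    apply/funext => m; rewrite /Sg gtildeE //;
      apply: eq_wsum_mem => w /perm_size ->.
    by rewrite eqxx.
  have -> : E = wsum (fun w => - (chi k (size w) * (sorted gtn w)%:R)).
    apply/funext => m; rewrite [LHS](_ : _ = - chi k (degree m) * sym_e (degree
      m) m).
      rewrite sym_eE -pserZE wsumZ.
      by apply: eq_wsum_mem => w /perm_size ->; rewrite eqxx /= mulNr.
    by rewrite mulNr.
  rewrite mulrC wsumM -wsum1; apply: eq_wsum => w.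
  rewrite big_nat_recl // take0 drop0 chi0 /= mulr1 opprK mul1r.
  case: (posnP (size w)) => [e|w0].
    rewrite e big_geq // addr0 (size0nil e) eqxx.
    by have -> : avoidw k [::] by apply/avoidwP => i /=; lia.
  rewrite -(avoidw_rec k1 w0) big_add1 /= -size_eq0 (gtn_eqF w0) -big_split /=.
  rewrite big_nat big1 // => i iw.
  by rewrite size_takel; [rewrite mulNr mulrA addrN|lia].
- move=> m; exists (degree m).+1.*2 => M mM.
  rewrite opprB addrC subrK pser_sumE.
  rewrite [RHS](_ : _ = - chi k (degree m) * sym_e (degree m) m) ?mulNr //.
  rewrite -mulNr -(altE k1 mM) mulr_suml.
  apply: eq_bigr => i _; rewrite /alt_e pserZE -mulrA; congr (_ * _).
  by case: eqP => [->|/eqP e]; rewrite ?mul1r // mul0r sym_e_homog // eq_sym.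
Qed.

(** * Sorted biwords and complete homogeneous functions *)

Definition lexle : rel (nat * nat) :=
  fun p q => (p.1 < q.1)%N || (p.1 == q.1) && (p.2 <= q.2)%N.

Lemma lexle_trans : transitive lexle.
Proof. by move=> [a b] [c d] [e f]; rewrite /lexle /=; lia. Qed.

Lemma lexle_total : total lexle.
Proof. by move=> [a b] [c d]; rewrite /lexle /=; lia. Qed.

Lemma lexle_anti : antisymmetric lexle.
Proof.
move=> [a b] [c d]; rewrite /lexle /= => H.
by have [-> ->] : a = c /\ b = d by lia.
Qed.

(** For l sorted: w is weakly increasing along every block of positions on which
    l is constant. *)
Definition biw (l w : seq nat) : bool :=
  (size w == size l) && sorted lexle (zip l w).

Definition swapp (p : nat * nat) := (p.2, p.1).

Lemma swappK : involutive swapp. Proof. by case. Qed.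

Lemma unzip1_swap s : unzip1 (map swapp s) = unzip2 s.
Proof. by rewrite /unzip1 -map_comp. Qed.

Lemma unzip2_swap s : unzip2 (map swapp s) = unzip1 s.
Proof. by rewrite /unzip2 -map_comp. Qed.

Lemma sorted_lexle_fst s : sorted lexle s -> sorted leq (unzip1 s).
Proof.
rewrite /unzip1 sorted_map; apply: sub_sorted => -[a b] [c d].
by rewrite /lexle /=; lia.
Qed.

(** A sorted biword is a matrix of multiplicities indexed by pairs of letters;
    this is the transposition of matrices. *)
Definition transpose_biw (l w : seq nat) : seq nat :=
  unzip2 (sort lexle (map swapp (zip l w))).

Section Transpose.
Variables (l l' w : seq nat).
Hypothesis sl' : sorted leq l'.
Hypotheses (wl' : perm_eq w l') (blw : biw l w).

Let sz : size w = size l. Proof. by apply/eqP; case/andP: blw. Qed.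

Let s := sort lexle (map swapp (zip l w)).

Let sE : zip l' (transpose_biw l w) = s.
Proof.
have -> : l' = unzip1 s.
  apply: (sorted_eq leq_trans anti_leq) => //.
    by apply: sorted_lexle_fst; apply: sort_sorted lexle_total _.
  rewrite perm_sym (perm_trans _ wl') //.
  rewrite -(unzip2_zip (eq_leq (esym (esym sz)))) -unzip1_swap.
  by apply: perm_map; rewrite perm_sort.
exact: zip_unzip.
Qed.

Lemma transpose_biw_perm : perm_eq (transpose_biw l w) l.
Proof.
rewrite -[X in perm_eq _ X](unzip1_zip (eq_leq (esym sz))) -unzip2_swap.
by apply: perm_map; rewrite perm_sort.
Qed.

Lemma transpose_biw_biw : biw l' (transpose_biw l w).
Proof.
rewrite /biw (perm_size transpose_biw_perm) -sz (perm_size wl') eqxx sE.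
exact: sort_sorted lexle_total _.
Qed.

Lemma transpose_biwK : transpose_biw l' (transpose_biw l w) = w.
Proof.
rewrite {1}/transpose_biw sE -[RHS](unzip2_zip (eq_leq sz)); congr unzip2.
apply: (sorted_eq lexle_trans lexle_anti).
- exact: sort_sorted lexle_total _.
- by case/andP: blw.
rewrite perm_sort -[X in perm_eq _ X](mapK swappK).
by apply: perm_map; rewrite perm_sort.
Qed.

End Transpose.

Lemma leq_size_inj (T U : eqType) (f : T -> U) (s : seq T) (t : seq U) :
  uniq s -> {in s &, injective f} -> (forall x, x \in s -> f x \in t) ->
  (size s <= size t)%N.
Proof.
move=> us fi st; rewrite -(size_map f); apply: uniq_leq_size.
  by rewrite map_inj_in_uniq.
by move=> _ /mapP[x xs ->]; apply: st.
Qed.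

(** Both sides count matrices of natural numbers, with row sums the
    multiplicities of l and column sums those of l', or conversely. *)
Lemma biw_count_sym l l' : sorted leq l -> sorted leq l' ->
  count (biw l) (permutations l') = count (biw l') (permutations l).
Proof.
have le u v : sorted leq u -> sorted leq v ->
    (count (biw u) (permutations v) <= count (biw v) (permutations u))%N.
  move=> su sv; rewrite -!size_filter.
  apply: (@leq_size_inj _ _ (transpose_biw u)).
  - by rewrite filter_uniq ?permutations_uniq.
  - move=> w w'; rewrite !mem_filter !mem_permutations.
    move=> /andP[bw wv] /andP[bw' wv'] /(congr1 (transpose_biw v)).
    by rewrite !(transpose_biwK (l := u)).
  - move=> w; rewrite !mem_filter !mem_permutations => /andP[bw wv].
    by rewrite (transpose_biw_biw sv) // transpose_biw_perm.
by move=> sl sl'; apply/eqP; rewrite eqn_leq !le.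
Qed.

(** Standardization: the case of a biword whose second row is a permutation of
    0, ..., n-1. *)
Lemma count_words_biw l : sorted leq l ->
  count (biw l) (permutations (iota 0 (size l))) = size (permutations l).
Proof.
move=> sl; rewrite biw_count_sym ?iota_sorted //.
rewrite -[RHS]count_predT; apply: eq_in_count => w.
rewrite mem_permutations => /perm_size sw.
rewrite /biw size_iota sw eqxx /=; apply/(sortedP (0, 0)%N) => i.
rewrite size_zip size_iota sw minnn => il.
by rewrite !nth_zip ?size_iota //= !nth_iota /lexle /=; lia.
Qed.

Definition block_word (c : nat -> nat) (S : seq nat) : seq nat :=
  flatten [seq nseq (c i) i | i <- S].

Lemma mem_block_word c S x : x \in block_word c S -> x \in S.
Proof. by move=> /flattenP[_ /mapP[i iS ->]];
  rewrite mem_nseq => /andP[_ /eqP ->]. Qed.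

Lemma sorted_block_word c S : sorted ltn S -> sorted leq (block_word c S).
Proof.
elim: S => [|i S IH] //=; rewrite (path_sortedE ltn_trans) =>
  /andP[/allP iS sS].
rewrite [block_word _ _]/(nseq _ _ ++ block_word c S).
rewrite (sorted_pairwise leq_trans) pairwise_cat -!(sorted_pairwise leq_trans).
rewrite IH // andbT; apply/andP; split; last first.
  by apply/(sortedP 0%N) => j; rewrite size_nseq => jc; rewrite !nth_nseq;
    do 2!case: ifP; lia.
apply/allrelP => x y; rewrite mem_nseq => /andP[_ /eqP ->] /mem_block_word /iS.
exact: ltnW.
Qed.

Lemma count_block_word c S i : uniq S ->
  count_mem i (block_word c S) = if i \in S then c i else 0%N.
Proof.
elim: S => [|j S IH] //= /andP[jS uS].
rewrite [block_word _ _]/(nseq _ _ ++ block_word c S) count_cat IH //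
  count_nseq.
rewrite in_cons (eq_sym i) /=; case: (eqVneq j i) => [<-|_] /=.
  by rewrite mul1n (negPf jS) addn0.
by rewrite mul0n.
Qed.

Lemma block_word_sorted l S : sorted leq l -> sorted ltn S -> {subset l <= S} ->
  block_word (fun i => count_mem i l) S = l.
Proof.
move=> sl sS lS; apply: (sorted_eq leq_trans anti_leq) => //.
  exact: sorted_block_word.
apply/allP => i _ /=; rewrite count_block_word; last first.
  exact: sorted_uniq ltn_trans ltnn _ sS.
by case: ifP => // /negP iS; apply/eqP/esym/count_memPn/negP => /lS.
Qed.

Lemma sym_hE r :
  sym_h r = wsum (fun w => ((size w == r) && sorted leq w)%:R).
Proof.
rewrite /sym_h word_sumE; apply: eq_wsum => w.
by congr (nat_of_bool _)%:R; apply/asboolP/andP => -[/eqP].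
Qed.

Lemma biw_cat i r l w : {in l, forall j, i < j}%N ->
  biw (nseq r i ++ l) w = [&& (r <= size w)%N,
    sorted leq (take r w) & biw l (drop r w)].
Proof.
move=> il; rewrite /biw size_cat size_nseq size_drop.
case: (leqP r (size w)) => rw; last first.
  by rewrite /= [_ == _](_ : _ = false) //; lia.
have -> : (size w == r + size l)%N = (size w - r == size l)%N by lia.
case: eqP => sw; last by rewrite /= andbF.
rewrite /= -{1}(cat_take_drop r w) zip_cat ?size_nseq ?size_takel //.
rewrite (sorted_pairwise lexle_trans) pairwise_cat -!(sorted_pairwise
  lexle_trans).
have -> /= : allrel lexle (zip (nseq r i) (take r w)) (zip l (drop r w)).
  apply/allrelP => -[a b] [c d] ab cd.
  have /(map_f fst) := ab; rewrite -/(unzip1 _) unzip1_zip ?size_nseq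
    ?size_takel //=.
  rewrite mem_nseq => /andP[_ /eqP ->].
  have /(map_f fst) := cd; rewrite -/(unzip1 _) unzip1_zip ?size_drop ?sw //=.
  by move=> /il; rewrite /lexle /= => ->.
have zipE u : zip (nseq (size u) i) u = [seq (i, x) | x <- u].
  by elim: u => //= x u ->.
congr (_ && _); rewrite -{1}(size_takel rw) zipE sorted_map.
by apply: eq_sorted => x y; rewrite /lexle /= ltnn eqxx.
Qed.

Lemma wsum_biw_block c S : sorted ltn S ->
  wsum (fun w => (biw (block_word c S) w)%:R) = \prod_(i <- S) sym_h (c i).
Proof.
elim: S => [|i S IH] sS.
  rewrite big_nil -wsum1; apply: eq_wsum => w; rewrite /biw /= size_eq0.
  by case: eqP => [->|].
rewrite big_cons -IH; last exact: path_sorted sS.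
rewrite sym_hE wsum_split; apply: eq_wsum => w.
move: sS; rewrite /= (path_sortedE ltn_trans) => /andP[/allP iS _].
rewrite [block_word _ (_ :: _)]/(nseq _ _ ++ block_word c S) biw_cat //.
by move=> j /mem_block_word /iS.
Qed.

Lemma wsum_biwE l S : sorted leq l -> sorted ltn S -> {subset l <= S} ->
  wsum (fun w => (biw l w)%:R) = \prod_(i <- S) sym_h (count_mem i l).
Proof. by move=> sl sS lS; rewrite -wsum_biw_block // block_word_sorted. Qed.

Definition part_word (mu : seq nat) : seq nat :=
  block_word (nth 0%N mu) (iota 0 (size mu)).

Lemma sorted_part_word mu : sorted leq (part_word mu).
Proof. exact/sorted_block_word/iota_ltn_sorted. Qed.

Lemma wsum_biw_part mu : wsum (fun w => (biw (part_word mu) w)%:R) = prod_h mu.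
Proof.
rewrite wsum_biw_block ?iota_ltn_sorted // /prod_h.
by rewrite [RHS](big_nth 0%N) /index_iota subn0.
Qed.

Lemma wsum_biw_sym l l' : sorted leq l -> sorted leq l' ->
  wsum (fun w => (biw l w)%:R) (seq_mset l') = wsum (fun w =>
    (biw l' w)%:R) (seq_mset l).
Proof.
by move=> sl sl'; rewrite !wsum_seq !sum_natr_count biw_count_sym.
Qed.

(** * Symmetric series are polynomials in the complete homogeneous functions *)

Definition mults (m : mon) : seq nat := [seq m i | i <- finsupp m].

Definition symmetric_series (f : pser) : Prop :=
  forall m m', perm_eq (mults m) (mults m') -> f m = f m'.

Definition homogeneous n (f : pser) : Prop :=
  forall m : mon, degree m != n -> f m = 0.

Lemma sorted_mset (m : mon) :
  exists2 l, sorted leq l & seq_mset l = m.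
Proof.
exists (sort leq m); first exact: sort_sorted leq_total _.
by rewrite -[RHS](seq_mset_id m); apply/eq_seq_msetP; rewrite perm_sort.
Qed.

Lemma prod_h_perm mu nu : perm_eq mu nu -> prod_h mu = prod_h nu.
Proof. exact: perm_big. Qed.

(** Once transposed, the count of biwords is a coefficient of a product of h's
    that is indexed by the multiplicities of m, so it does not depend on their
    order. *)
Lemma wsum_biw_mults l m : sorted leq l ->
  wsum (fun w => (biw l w)%:R) m = prod_h (mults m) (seq_mset l).
Proof.
move=> sl; have [l' sl' <-] := sorted_mset m; rewrite wsum_biw_sym //.
set S := sort leq (finsupp (seq_mset l') : seq nat).
have pS : perm_eq S (finsupp (seq_mset l')) by rewrite perm_sort.
have sS : sorted ltn S.
  rewrite ltn_sorted_uniq_leq (perm_uniq pS) fset_uniq.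
  exact: sort_sorted leq_total _.
rewrite (wsum_biwE sl' sS); last first.
  by move=> x xl; rewrite (perm_mem pS) msuppE in_mset mset_seqE -has_count
    has_pred1.
rewrite /prod_h /mults big_map (perm_big _ pS) /=.
by under [in RHS]eq_bigr do rewrite mset_seqE.
Qed.

Lemma prod_h_sym mu : symmetric_series (prod_h mu).
Proof.
move=> m m' mm'; rewrite -!wsum_biw_part !wsum_biw_mults ?sorted_part_word //.
by rewrite (prod_h_perm mm').
Qed.

Lemma perm_mults (s : seq nat) :
  perm_eq (mults (seq_mset s)) [seq count_mem i s | i <- undup s].
Proof.
rewrite /mults (eq_map (mset_seqE s)); apply: perm_map.
apply: uniq_perm; rewrite ?fset_uniq ?undup_uniq // => x.
by rewrite msuppE in_mset mset_seqE mem_undup -has_count has_pred1.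
Qed.

Lemma sumn_mults (m : mon) : sumn (mults m) = degree m.
Proof. by rewrite /mults sumn_map size_mset. Qed.

Lemma mults0 (m : mon) : 0%N \notin mults m.
Proof.
by apply/negP => /mapP[i]; rewrite msuppE in_mset => + e; rewrite -e.
Qed.

Lemma perm_sumn (s t : seq nat) : perm_eq s t -> sumn s = sumn t.
Proof. by rewrite !sumnE; apply: perm_big. Qed.

Lemma mults_part_word (mu : seq nat) : 0%N \notin mu ->
  perm_eq (mults (seq_mset (part_word mu))) mu.
Proof.
move=> mu0; apply: (perm_trans (perm_mults _)).
have cE i : i \in iota 0 (size mu) ->
    count_mem i (part_word mu) = nth 0%N mu i.
  by move=> ii; rewrite /part_word count_block_word ?iota_uniq // ii.
rewrite -[X in perm_eq _ X](mkseq_nth 0%N) /mkseq;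
  have <- := iffLR (eq_in_map _ _ _) cE; apply: perm_map.
apply: uniq_perm; rewrite ?undup_uniq ?iota_uniq // => x.
rewrite mem_undup; apply/idP/idP => [/mem_block_word //|xi].
rewrite -has_pred1 has_count cE // lt0n; apply: contra mu0 => /eqP <-.
by apply: mem_nth; rewrite mem_iota in xi.
Qed.

Definition partitions n : seq (seq nat) := [seq mu <- compositions n n | is_part
  mu].

Lemma mem_partitions n mu : (mu \in partitions n) = part_of n mu.
Proof.
rewrite mem_filter mem_compositions // /part_of /comp_of /is_part.
by case: (0%N \notin mu); rewrite ?andbF ?andbT.
Qed.

Lemma partitions_uniq n : uniq (partitions n).
Proof. exact/filter_uniq/compositions_uniq. Qed.

Lemma geq_total : total geq. Proof. by move=> a b; rewrite /geq /=; lia. Qed.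
Lemma geq_trans : transitive geq. Proof. by move=> a b c; rewrite /geq /=; lia.
Qed.
Lemma geq_anti : antisymmetric geq. Proof. by move=> a b; rewrite /geq /=; lia.
Qed.

Lemma part_of_sort n mu : 0%N \notin mu -> sumn mu = n ->
  part_of n (sort geq mu).
Proof.
move=> mu0 sm; rewrite /part_of /is_part sort_sorted ?mem_sort ?mu0 /=;
  last first.
  exact: geq_total.
by rewrite (perm_sumn (t := mu)) ?sm // perm_sort.
Qed.

Lemma part_perm_eq lam mu : is_part lam -> is_part mu -> perm_eq lam mu ->
  lam = mu.
Proof. by move=> /andP[sl _] /andP[sm _];
  apply: sorted_eq geq_trans geq_anti _ _ sl sm. Qed.

Definition hspan n (f : pser) : Prop :=
  exists2 s : seq (rat * seq nat), all (fun p => comp_of n p.2) s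
    & f = \sum_(p <- s) p.1 *: prod_h p.2.

Lemma hspan0 n : hspan n 0.
Proof. by exists [::]; rewrite ?big_nil. Qed.

Lemma hspanD n f g : hspan n f -> hspan n g -> hspan n (f + g).
Proof.
move=> [s ss ->] [t tt ->]; exists (s ++ t); first by rewrite all_cat ss.
by rewrite big_cat.
Qed.

Lemma hspanZ n a f : hspan n f -> hspan n (a *: f).
Proof.
move=> [s ss ->]; exists [seq (a * p.1, p.2) | p <- s];
  first by rewrite all_map.
by rewrite big_map scaler_sumr; apply: eq_bigr => p _; rewrite scalerA.
Qed.

Lemma hspanB n f g : hspan n f -> hspan n g -> hspan n (f - g).
Proof. by move=> hf hg; rewrite -scaleN1r; apply: hspanD hf (hspanZ _ hg). Qed.

Lemma hspan_sum n I (r : seq I) (P : pred I) (F : I -> pser) :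
  (forall i, P i -> hspan n (F i)) -> hspan n (\sum_(i <- r | P i) F i).
Proof. by move=> H; apply: big_ind => //; [exact: hspan0 | exact: hspanD]. Qed.

Lemma hspan_prod n mu : comp_of n mu -> hspan n (prod_h mu).
Proof. by move=> c; exists [:: (1, mu)]; rewrite /= ?c // big_seq1 scale1r. Qed.

Lemma hspanM n p f g : hspan n f -> hspan p g -> hspan (n + p) (f * g).
Proof.
move=> [s /allP ss ->] [t /allP tt ->]; rewrite big_distrlr /= !big_seq.
apply: hspan_sum => a /ss ca; rewrite big_seq; apply: hspan_sum => b /tt cb.
rewrite -pser_scaleAl -pser_scaleAr; apply/hspanZ/hspanZ.
rewrite /prod_h -big_cat; apply: hspan_prod; move: ca cb.
rewrite /comp_of mem_cat sumn_cat =>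
  /andP[/negPf -> /eqP ->] /andP[/negPf -> /eqP ->].
by rewrite eqxx.
Qed.

Lemma hspan_sym n f : hspan n f -> symmetric_series f.
Proof.
move=> [s _ ->] m m' mm'; rewrite !pser_sumE; apply: eq_bigr => p _.
by rewrite !pserZE (prod_h_sym _ mm').
Qed.

Lemma size_part_word mu : 0%N \notin mu -> size (part_word mu) = sumn mu.
Proof.
move=> /mults_part_word /perm_sumn <-; rewrite sumn_mults.
exact/esym/perm_size/perm_eq_seq_mset.
Qed.

Lemma hspan_homog n f : hspan n f -> homogeneous n f.
Proof.
move=> [s /allP sn ->] m mn; rewrite pser_sumE big_seq big1 // => p /sn.
move=> /andP[p0 /eqP sp]; rewrite pserZE -wsum_biw_part /wsum big_seq big1
  ?mulr0 // => w.
rewrite mem_permutations /biw => /perm_size ->.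
by rewrite size_part_word // sp (negPf mn).
Qed.

Lemma hspan_partitions n f : hspan n f ->
  exists a : seq nat -> rat, f = \sum_(lam <- partitions n) a lam *: prod_h lam.
Proof.
case=> s; elim: s f => [|[c mu] s IH] f /=.
  by move=> _ ->; exists (fun=> 0); rewrite big_nil big1 // => i _;
    rewrite scale0r.
move=> /andP[/andP[mu0 /eqP sm] ss ->]; rewrite big_cons.
have [a ->] := IH _ ss erefl.
set lam := sort geq mu; have lamP : lam \in partitions n.
  by rewrite mem_partitions part_of_sort.
exists (fun nu => a nu + (if nu == lam then c else 0)).
under [RHS]eq_bigr do rewrite scalerDl.
rewrite big_split /= addrC; congr (_ + _).
rewrite (bigD1_seq lam) ?partitions_uniq //= eqxx big1 ?addr0.
  by congr (_ *: _); apply: prod_h_perm; rewrite perm_sym perm_sort.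
by move=> nu /negPf ->; rewrite scale0r.
Qed.

(** * Power sums *)

Definition power_sum (r : nat) : pser :=
  wsum (fun w => ((size w == r) && constant w)%:R).

Lemma constant_head r w : (0 < r)%N -> (size w == r) && constant w ->
  w = nseq r (head 0%N w).
Proof.
by case: w => [|x w] r0 /andP[/eqP <-] //= /all_pred1P e; rewrite [in LHS]e.
Qed.

Lemma count_sorted (s : seq nat) : count (sorted leq) (permutations s) = 1%N.
Proof.
rewrite (eq_in_count (a2 := pred1 (sort leq s))) => [|w].
  by rewrite (count_uniq_mem _ (permutations_uniq s)) mem_permutations perm_sort
    perm_refl.
rewrite mem_permutations => ws; apply/idP/eqP => [sw|->].
  apply: (sorted_eq leq_trans anti_leq) => //;
    first exact: sort_sorted leq_total _.
  by rewrite (perm_trans ws) // perm_sym perm_sort.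
exact: sort_sorted leq_total _.
Qed.

(** Among the rearrangements of s, a word made of r equal letters followed by a
    sorted word is determined by its first letter. *)
Lemma count_power_sum_h (s : seq nat) r : (0 < r)%N ->
  count (fun w => [&& (r <= size w)%N,
    constant (take r w) & sorted leq (drop r w)])
    (permutations s) = count (fun i => r <= count_mem i s)%N (undup s).
Proof.
move=> r0; rewrite -!size_filter.
pose g i := nseq r i ++ sort leq ([seq j <- s | j != i] ++ nseq (count_mem i s -
  r) i).
rewrite -(size_map g); apply/perm_size/uniq_perm.
- by rewrite filter_uniq ?permutations_uniq.
- rewrite map_inj_in_uniq ?filter_uniq ?undup_uniq // => i j _ _.
  by move/(congr1 (head 0%N)); rewrite /g; case: (r) r0 => // n _ /=.
have gperm i : (r <= count_mem i s)%N -> perm_eq (g i) s.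
  move=> ri; rewrite /g perm_sym -(perm_filterC (pred1 i)) perm_sym.
  rewrite (perm_trans (y := nseq r i ++ ([seq j <- s | j != i] ++ nseq
    (count_mem i s - r) i))) //.
    by rewrite perm_cat2l perm_sort.
  rewrite perm_catCA -[X in perm_eq X]/(_ ++ _) perm_catC perm_cat2r.
  rewrite -nseqD subnKC // -size_filter.
  rewrite [X in perm_eq _ X](_ : _ = nseq (size (filter (pred1 i) s)) i) //.
  by apply/all_pred1P/allP => x; rewrite mem_filter => /andP[].
move=> w; rewrite mem_filter mem_permutations; apply/idP/mapP.
  move=> /andP[/and3P[rw cw sw] ws]; set i := head 0%N (take r w).
  have wE : take r w = nseq r i.
    by apply: constant_head; rewrite ?size_takel ?eqxx.
  have ri : (r <= count_mem i s)%N.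
    rewrite -(seq.permP ws) -(cat_take_drop r w) count_cat wE count_nseq /= eqxx
      mul1n.
    exact: leq_addr.
  exists i.
    by rewrite mem_filter ri mem_undup -has_pred1 has_count;
      apply: leq_trans ri.
  rewrite -(cat_take_drop r w) wE /g; congr (_ ++ _).
  apply: (sorted_eq leq_trans anti_leq) => //;
    first exact: sort_sorted leq_total _.
  rewrite perm_sym perm_sort -(perm_cat2l (nseq r i)) perm_sym -wE cat_take_drop
    wE.
  rewrite (perm_trans ws) // perm_sym (perm_trans _ (gperm i ri)) //.
  by rewrite perm_cat2l perm_sym perm_sort.
move=> [i]; rewrite mem_filter => /andP[ri _] ->; rewrite gperm // andbT.
rewrite /g size_cat size_nseq leq_addr take_size_cat ?drop_size_cat ?size_nseq
  //=.
rewrite (sort_sorted leq_total) andbT.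
by case: (r) => //= n; apply/all_pred1P; rewrite size_nseq.
Qed.

(** At the monomial of a word s, the product p_r h_(n-r) counts the letters that
    occur at least r times in s; over all r >= 1, a letter is counted as often
    as it occurs. *)
Lemma newton n : (0 < n)%N ->
  n%:R *: sym_h n = \sum_(1 <= r < n.+1) power_sum r * sym_h (n - r).
Proof.
move=> n0; apply/funext => m; rewrite pserZE pser_sumE.
have [s _ <-] := sorted_mset m.
rewrite sym_hE wsum_seq.
case: (eqVneq (size s) n) => [sn|sn]; last first.
  rewrite big_seq big1 ?mulr0 => [|w]; last first.
    by rewrite mem_permutations => /perm_size ->; rewrite (negPf sn).
  rewrite big_nat big1 // => r rn.
  rewrite /power_sum sym_hE wsum_split wsum_seq big_seq big1 // => w.
  rewrite mem_permutations => /perm_size sw; rewrite size_drop sw.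
  by case: leqP => //= rs; rewrite [_ == _](_ : _ = false) ?andbF //; lia.
transitivity ((\sum_(1 <= r < n.+1) count (fun i =>
  r <= count_mem i s)%N (undup s))%N%:R : rat);
  last first.
  rewrite natr_sum !big_nat; apply: eq_bigr => r rn.
  rewrite -count_power_sum_h ?sym_hE ?/power_sum ?wsum_split ?wsum_seq;
    last by lia.
  rewrite -sum_natr_count !big_seq; apply: eq_bigr => w.
  rewrite mem_permutations => /perm_size sw; rewrite size_drop sw sn eqxx.
  by case: leqP.
rewrite (eq_big_seq (fun w => (sorted leq w)%:R)) => [|w]; last first.
  by rewrite mem_permutations => /perm_size ->; rewrite sn eqxx.
rewrite sum_natr_count count_sorted mulr1; congr _%:R.
under eq_bigr do rewrite -sum1_count big_mkcond /=.
rewrite exchange_big /= -sn -{1}(perm_size (perm_count_undup s)) size_flatten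
  /shape.
rewrite -map_comp sumn_map; apply: eq_big_seq => i; rewrite mem_undup => si.
rewrite -big_mkcond /= size_nseq.
rewrite (big_cat_nat (n := (count_mem i s).+1)) //=;
  last by rewrite ltnS count_size.
rewrite [X in (_ + X)%N]big_nat_cond [X in (_ + X)%N]big_pred0 ?addn0;
  last first.
  by move=> r; rewrite [(r <= _)%N]leqNgt; case: (count_mem i s < r)%N;
    rewrite ?andbF.
rewrite big_nat_cond (eq_bigl (fun r => 1 <= r < (count_mem i s).+1)%N) => [|r].
  by rewrite -big_nat sum_nat_const_nat muln1 subn1.
by rewrite ltnS; case: (r <= _)%N; rewrite ?andbT ?andbF.
Qed.

Lemma sym_h0 : sym_h 0 = 1.
Proof.
rewrite sym_hE -wsum1; apply: eq_wsum => w; rewrite size_eq0.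
by case: eqP => // ->.
Qed.

Lemma hspan_h n : hspan n (sym_h n).
Proof.
case: (posnP n) => [->|n0].
  have -> : sym_h 0 = prod_h [::] by rewrite /prod_h big_nil sym_h0.
  exact: hspan_prod.
have -> : sym_h n = prod_h [:: n] by rewrite /prod_h big_seq1.
by apply: hspan_prod; rewrite /comp_of inE /= addn0 eqxx andbT eq_sym -lt0n.
Qed.

Lemma hspan_power_sum n : (0 < n)%N -> hspan n (power_sum n).
Proof.
elim/ltn_ind: n => n IH n0; have := newton n0.
rewrite big_nat_recr //= subnn sym_h0 mulr1 => e.
have -> : power_sum n = n%:R *: sym_h n
    - \sum_(1 <= r < n) power_sum r * sym_h (n - r) by rewrite e [X in X -
        _]addrC addrK.
apply: hspanB; first exact/hspanZ/hspan_h.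
rewrite big_nat; apply: hspan_sum => r rn; rewrite -{1}(@subnKC r n);
  last by lia.
by apply: hspanM (hspan_h _); apply: IH; lia.
Qed.

Fixpoint constant_blocks (mu w : seq nat) : bool :=
  if mu is r :: nu then
    [&& (r <= size w)%N, constant (take r w) & constant_blocks nu (drop r w)]
  else w == [::].

Definition prod_p (mu : seq nat) : pser := \prod_(r <- mu) power_sum r.

Lemma prod_pE mu : prod_p mu = wsum (fun w => (constant_blocks mu w)%:R).
Proof.
rewrite /prod_p; elim: mu => [|r nu IH]; first by rewrite big_nil wsum1.
by rewrite big_cons IH wsum_split.
Qed.

Lemma hspan_prod_p n mu : comp_of n mu -> hspan n (prod_p mu).
Proof.
rewrite /prod_p; elim: mu n => [|r nu IH] n.
  have -> : \prod_(r <- [::]) power_sum r = prod_h [::] by rewrite /prod_h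
    !big_nil.
  exact: hspan_prod.
rewrite /comp_of inE negb_or => /andP[/andP[r0 nu0] /= /eqP <-].
rewrite big_cons; apply: hspanM.
  by apply: hspan_power_sum; rewrite lt0n eq_sym.
by apply: IH; rewrite /comp_of nu0 eqxx.
Qed.

Lemma constant_blocksP mu w : 0%N \notin mu -> constant_blocks mu w ->
  exists2 c : seq nat, size c = size mu
    & w = flatten [seq nseq p.1 p.2 | p <- zip mu c].
Proof.
elim: mu w => [|r nu IH] w /=; first by move=> _ /eqP ->; exists [::].
rewrite inE negb_or => /andP[r0 nu0] /and3P[rw cw /(IH _ nu0)[c sc wE]].
exists (head 0%N (take r w) :: c); first by rewrite /= sc.
rewrite /= -wE -{1}(cat_take_drop r w); congr (_ ++ _); apply: constant_head.
  by rewrite lt0n eq_sym.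
by rewrite size_takel ?eqxx.
Qed.

Lemma constant_blocks_block_word (c : nat -> nat) S :
  constant_blocks (map c S) (block_word c S).
Proof.
elim: S => //= i S IH.
rewrite [block_word _ _]/(nseq _ _ ++ block_word c S) size_cat size_nseq
  leq_addr.
rewrite take_size_cat ?drop_size_cat ?size_nseq // IH andbT /=.
by case: (c i) => //= n; apply/all_pred1P; rewrite size_nseq.
Qed.

Lemma constant_blocks_mults mu w : 0%N \notin mu -> constant_blocks mu w ->
  (size (undup w) <= size mu)%N /\
  (size (undup w) = size mu -> perm_eq (mults (seq_mset w)) mu).
Proof.
move=> mu0 /(constant_blocksP mu0)[c sc wE].
have wc : {subset undup w <= c}.
  move=> x; rewrite mem_undup wE => /flattenP[_ /mapP[[a b] /= + ->]].
  rewrite mem_nseq => ab /andP[_ /eqP ->].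
  by have /(map_f snd) := ab; rewrite -/(unzip2 _) unzip2_zip // sc.
split; first by rewrite -sc; apply: uniq_leq_size (undup_uniq _) wc.
move=> sw; have sc' : (size c <= size (undup w))%N by rewrite sw sc.
have uc := leq_size_uniq (undup_uniq w) wc sc'.
have [_ wcE] := uniq_min_size (undup_uniq w) wc sc'.
apply: (perm_trans (perm_mults _)).
apply: (perm_trans (y := [seq count_mem i w | i <- c])).
  by apply/perm_map/uniq_perm; rewrite ?undup_uniq.
suff -> : [seq count_mem i w | i <- c] = mu by [].
move: sc uc; rewrite wE; clear;
  elim: mu c => [|r nu IH] [|x c] //= [sc] /andP[xc uc].
congr (_ :: _).
  rewrite count_cat count_nseq /= eqxx mul1n; apply/eqP;
    rewrite -[X in _ == X]addn0 eqn_add2l.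
  apply/eqP/count_memPn; apply: contra xc => /flattenP[_ /mapP[[a b] /= ab ->]].
  rewrite mem_nseq => /andP[_ /eqP ->].
  by have /(map_f snd) := ab; rewrite -/(unzip2 _) unzip2_zip // sc.
rewrite -[RHS](IH c) //; apply/eq_in_map => y yc.
rewrite count_cat count_nseq /=; case: eqP => [xy|_]; last by rewrite mul0n.
by rewrite xy yc in xc.
Qed.

Lemma prod_p_part_word mu : prod_p mu (seq_mset (part_word mu)) != 0.
Proof.
rewrite prod_pE wsum_seq sum_natr_count pnatr_eq0 -lt0n -has_count.
apply/hasP; exists (part_word mu); first by rewrite mem_permutations.
rewrite -{1}(mkseq_nth 0%N mu); exact: constant_blocks_block_word.
Qed.

Lemma prod_p_neq0 mu m : 0%N \notin mu -> prod_p mu m != 0 ->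
  (size (mults m) <= size mu)%N /\
  (size (mults m) = size mu -> perm_eq (mults m) mu).
Proof.
move=> mu0; have [s _ <-] := sorted_mset m.
rewrite prod_pE wsum_seq sum_natr_count pnatr_eq0 -lt0n -has_count.
move=> /hasP[w]; rewrite mem_permutations => /eq_seq_msetP <-.
move=> /(constant_blocks_mults mu0).
by rewrite (perm_size (perm_mults w)) size_map.
Qed.

(** Triangularity: a product of power sums p_lam is supported on monomials with
    at most size lam variables, and with exactly that many only on those of
    shape lam. So a suitable combination of them cancels the terms with the most
    variables. *)
Lemma symmetric_hspan n f : (0 < n)%N -> symmetric_series f ->
  homogeneous n f ->
  hspan n f.
Proof.
move=> n0 sf hf.
have : forall m, f m != 0 -> (size (mults m) <= n)%N.
  move=> m fm; have := mults0 m; have : sumn (mults m) = n.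
    by rewrite sumn_mults; apply/eqP; apply: contraNT fm => /hf ->.
  move=> <-; elim: (mults m) => //= a s IH;
    rewrite inE negb_or => /andP[a0 /IH].
  by move: a0; case: a => // a _; rewrite addSn ltnS => /leq_trans; apply;
    rewrite leq_addl.
move: {1}n => d; elim: d f sf hf => [|d IH] f sf hf fd.
  suff -> : f = 0 by exact: hspan0.
  apply/funext => m; rewrite pser0E; case: (eqVneq (f m) 0) => // fm.
  move: (fd m fm); rewrite leqn0 size_eq0 => /eqP m0; apply: hf.
  by rewrite -sumn_mults m0 /= eq_sym -lt0n.
(* g has the same terms in d.+1 variables as f. *)
pose g := \sum_(lam <- partitions n | size lam == d.+1)
  (f (seq_mset (part_word lam)) / prod_p lam (seq_mset (part_word lam))) *:
    prod_p lam.
have hg : hspan n g.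
  rewrite /g big_seq_cond; apply: hspan_sum => lam /andP[+ _].
  rewrite mem_partitions => /andP[/andP[_ l0] sl].
  by apply/hspanZ/hspan_prod_p; rewrite /comp_of l0.
have homg := hspan_homog hg.
suff : hspan n (f - g) by move=> /hspanD /(_ hg); rewrite subrK.
apply: IH.
- by move=> m m' mm'; rewrite !pserDE !pserNE (sf _ _ mm') (hspan_sym hg mm').
- by move=> m dm; rewrite pserDE pserNE hf ?homg ?subr0.
move=> m; apply: contraR; rewrite -ltnNge => dm; rewrite pserDE pserNE.
case: (eqVneq (degree m) n) => [mn|mn]; last by rewrite hf ?homg ?subr0.
have p0 lam : size lam = d.+1 -> lam \in partitions n ->
  ~~ perm_eq (mults m) lam ->
    prod_p lam m = 0.
  rewrite mem_partitions => sl /andP[/andP[_ l0] _] np; apply/eqP;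
    apply: contraNT np.
  by move=> /(prod_p_neq0 l0)[le]; apply; apply/eqP; rewrite eqn_leq le sl.
have : perm_eq (sort geq (mults m)) (mults m) by rewrite perm_sort.
set lam := sort geq _ => lm.
have lamP : lam \in partitions n.
  by rewrite mem_partitions; apply: part_of_sort; rewrite ?mults0 ?sumn_mults.
have lamm : perm_eq (mults m) (mults (seq_mset (part_word lam))).
  rewrite perm_sym (perm_trans _ lm) // mults_part_word // (perm_mem lm).
  exact: mults0.
have p0' nu : size nu = d.+1 -> nu \in partitions n -> nu != lam ->
  prod_p nu m = 0.
  move=> sn nuP nl; apply: p0 => //; apply: contra nl => mnu; apply/eqP.
  move: nuP lamP; rewrite !mem_partitions => /andP[n1 _] /andP[l1 _].
  by apply: part_perm_eq => //; rewrite perm_sym (perm_trans lm).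
rewrite /g pser_sumE; case: (eqVneq (size lam) d.+1) => sl; last first.
  have -> : f m = 0.
    apply/eqP; apply: contraNT sl => /fd; rewrite -(perm_size lm) => le.
    by rewrite eqn_leq le (perm_size lm).
  rewrite big_seq_cond big1 ?subr0 // => nu /andP[nuP /eqP sn].
  by rewrite pserZE p0' ?mulr0 //; apply: contraNneq sl => <-; rewrite sn.
rewrite -big_filter (bigD1_seq lam) /= ?filter_uniq ?compositions_uniq //;
  last first.
  by rewrite mem_filter sl eqxx.
rewrite big_seq_cond big1 ?addr0; last first.
  move=> nu /andP[]; rewrite mem_filter => /andP[/eqP sn nuP] nl.
  by rewrite pserZE p0' ?mulr0.
have hp : hspan n (prod_p lam).
  move: lamP; rewrite mem_partitions => /andP[/andP[_ l0] sl'].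
  by apply: hspan_prod_p; rewrite /comp_of l0.
rewrite pserZE (sf _ _ lamm) (hspan_sym hp lamm) mulfVK ?subrr //.
exact: prod_p_part_word.
Qed.

(** * Evaluating the Hall form *)

Lemma sum_sym_m n g : symmetric_series g -> homogeneous n g ->
  g = \sum_(lam <- partitions n) g (seq_mset (part_word lam)) *: sym_m lam.
Proof.
move=> sg hg; apply/funext => m; rewrite pser_sumE.
case: (eqVneq (degree m) n) => [mn|mn]; last first.
  rewrite hg // big_seq big1 // => lam;
    rewrite mem_partitions => /andP[_ /eqP sl].
  rewrite pserZE /sym_m -/(mults m); case: (boolP (perm_eq _ _)) => [|_];
    last by rewrite mulr0.
  by move/perm_sumn; rewrite sl sumn_mults => e; rewrite e eqxx in mn.
have lm : perm_eq (sort geq (mults m)) (mults m) by rewrite perm_sort.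
have lamP : sort geq (mults m) \in partitions n.
  by rewrite mem_partitions; apply: part_of_sort; rewrite ?mults0 ?sumn_mults.
rewrite (bigD1_seq _ lamP) ?partitions_uniq //= big_seq_cond big1 ?addr0;
  last first.
  move=> nu /andP[nuP nl]; rewrite pserZE /sym_m -/(mults m).
  case: (boolP (perm_eq _ _)) => [nm|_]; last by rewrite mulr0.
  case/eqP: nl; move: nuP lamP;
    rewrite !mem_partitions => /andP[n1 _] /andP[l1 _].
  by apply: part_perm_eq => //; rewrite (perm_trans nm) // perm_sym.
rewrite pserZE /sym_m -/(mults m) lm mulr1; apply: sg.
by rewrite perm_sym (perm_trans _ lm) // mults_part_word // (perm_mem lm)
  mults0.
Qed.

Lemma sum_sym_m_coef (s : seq (seq nat)) (b : seq nat -> rat) lam :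
  uniq s -> all is_part s -> lam \in s ->
  (\sum_(nu <- s) b nu *: sym_m nu) (seq_mset (part_word lam)) = b lam.
Proof.
move=> us /allP sp ls; have /andP[_ l0] := sp _ ls.
rewrite pser_sumE (bigD1_seq lam) //= big_seq_cond big1 ?addr0; last first.
  move=> nu /andP[ns nl]; rewrite pserZE /sym_m -/(mults _).
  rewrite (permPr (mults_part_word l0)).
  case: (boolP (perm_eq _ _)) => [nm|_]; last by rewrite mulr0.
  by case/eqP: nl; apply: part_perm_eq; rewrite ?sp.
by rewrite pserZE /sym_m -/(mults _) (permPr (mults_part_word l0)) perm_refl
  mulr1.
Qed.

(** By the symmetry of the number of biwords, the Hall form pairs the series of
    l, which is a product of h's, with f to the coefficient of the monomial l in
    f. *)
Lemma hallE n f (E : seq (rat * seq nat)) :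
  (0 < n)%N -> hspan n f -> all (fun p =>
    (size p.2 == n) && sorted leq p.2) E ->
  hall f (\sum_(p <- E) p.1 *: wsum (fun w => (biw p.2 w)%:R)) =
  \sum_(p <- E) p.1 * f (seq_mset p.2).
Proof.
move=> n0 hf /allP EP; set g := \sum_(p <- E) _.
have gP m : g m = \sum_(p <- E) p.1 * wsum (fun w => (biw p.2 w)%:R) m.
  by rewrite /g pser_sumE.
have sg : symmetric_series g.
  move=> m m' mm'; rewrite !gP big_seq [RHS]big_seq.
  apply: eq_bigr => p /EP /andP[_ sp]; rewrite !wsum_biw_mults //.
  by rewrite (prod_h_perm mm').
have hg : homogeneous n g.
  move=> m mn; rewrite gP big_seq big1 // => p /EP /andP[/eqP sp _].
  rewrite /wsum big_seq big1 ?mulr0 // => w.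
  by rewrite mem_permutations /biw => /perm_size ->; rewrite sp (negPf mn).
(* Every expansion of f and g gives the same value. *)
have val c : (exists (s : seq (seq nat)) (a b : seq nat -> rat),
    [/\ uniq s, all is_part s,
        f = \sum_(lam <- s) a lam *: prod_h lam,
        g = \sum_(lam <- s) b lam *: sym_m lam
      & c = \sum_(lam <- s) a lam * b lam]) ->
        c = \sum_(p <- E) p.1 * f (seq_mset p.2).
  move=> [s [a [b [us sp fE gE ->]]]].
  transitivity (\sum_(lam <- s) a lam * g (seq_mset (part_word lam))).
    rewrite !big_seq; apply: eq_bigr => lam ls; congr (_ * _).
    by rewrite gE sum_sym_m_coef.
  under eq_bigr do rewrite gP mulr_sumr.
  rewrite exchange_big !big_seq; apply: eq_bigr => p /EP /andP[_ pE] /=.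
  rewrite fE pser_sumE mulr_sumr; apply: eq_bigr => lam _.
  rewrite pserZE mulrCA; congr (_ * (_ * _)).
  by rewrite -wsum_biw_part wsum_biw_sym // sorted_part_word.
have [a fE] := hspan_partitions hf.
have ex : exists (s : seq (seq nat)) (a b : seq nat -> rat),
    [/\ uniq s, all is_part s,
        f = \sum_(lam <- s) a lam *: prod_h lam,
        g = \sum_(lam <- s) b lam *: sym_m lam
      & \sum_(p <- E) p.1 * f (seq_mset p.2) = \sum_(lam <- s) a lam * b lam].
  exists (partitions n), a, (fun lam => g (seq_mset (part_word lam))).
  have gE := sum_sym_m sg hg; split=> //; first exact: partitions_uniq.
    by apply/allP => lam; rewrite mem_filter => /andP[].
  apply/esym/val; exists (partitions n), a, (fun lam =>
    g (seq_mset (part_word lam))).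
  split=> //; first exact: partitions_uniq.
  by apply/allP => lam; rewrite mem_filter => /andP[].
by rewrite /hall; apply: xget_unique.
Qed.

(** * Descent classes *)

(** The corrections that cancel alpha on the sets of size d only change it on
    smaller sets. *)
Lemma moebius_sets (T : finType) (alpha : {set T} -> rat) :
  exists eps : {set T} -> rat,
    forall D, alpha D = \sum_(J : {set T}) eps J * (D \subset J)%:R.
Proof.
suff H d (a : {set T} -> rat) : (forall D, a D != 0 -> (#|D| < d)%N) ->
    exists eps : {set T} -> rat,
    forall D, a D = \sum_(J : {set T}) eps J * (D \subset J)%:R.
  by apply: (H #|T|.+1) => D _; rewrite ltnS max_card.
elim: d a => [|d IH] a ad.
  exists (fun=> 0) => D; rewrite big1 => [|J _]; last by rewrite mul0r.
  by apply/eqP; apply: contraT => /ad.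
pose b (J : {set T}) := if #|J| == d then a J else 0.
have [|eps eE] := IH (fun D : {set T} =>
  a D - \sum_(J : {set T}) b J * (D \subset J)%:R).
  move=> D; apply: contraR; rewrite -leqNgt => dD; rewrite subr_eq0; apply/eqP.
  rewrite (bigD1 D) //= subxx mulr1 big1 ?addr0 => [|J JD]; last first.
    rewrite /b; case: eqP => [Jd|_]; last by rewrite mul0r.
    case: (boolP (D \subset J)) => [DJ|]; last by rewrite mulr0.
    by case/eqP: JD; apply/esym/eqP; rewrite eqEcard DJ Jd.
  rewrite /b; case: eqP => // /eqP nd; apply/eqP; apply: contraR nd => /ad.
  by rewrite ltnS eqn_leq dD => ->.
exists (fun J => eps J + b J) => D.
by under eq_bigr do rewrite mulrDl; rewrite big_split -eE /= subrK.
Qed.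

(** The word counting, at each position, the elements of J before it: it is
    constant exactly on the blocks of the composition co(J). *)
Definition rank_word n (J : {set 'I_n.-1}) : seq nat :=
  mkseq (fun i => #|[set j : 'I_n.-1 in J | (j < i)%N]|) n.

Lemma rank_word_nth n (J : {set 'I_n.-1}) (i : 'I_n.-1) :
  nth 0%N (rank_word J) i.+1 = ((i \in J) + nth 0%N (rank_word J) i)%N.
Proof.
have := ltn_ord i => iN; rewrite !nth_mkseq; try lia.
rewrite (finset.cardsD1 i) !inE ltnSn andbT; congr (_ + _)%N.
apply: eq_card => j; rewrite !inE ltnS [(j <= i)%N]leq_eqVlt -(inj_eq val_inj).
by case: eqVneq => [->|] //=; rewrite ltnn andbF.
Qed.

Lemma rank_word_sorted n (J : {set 'I_n.-1}) : sorted leq (rank_word J).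
Proof.
apply/(sortedP 0%N) => i; rewrite size_mkseq => iN.
have iN' : (i < n.-1)%N by lia.
by rewrite (rank_word_nth J (Ordinal iN')) leq_addl.
Qed.

Lemma biw_rank_word n (J : {set 'I_n.-1}) w :
  biw (rank_word J) w = (size w == n) && (descents n w \subset J).
Proof.
rewrite /biw size_mkseq; case: eqP => //= sw.
have sz : size (zip (rank_word J) w) = n by rewrite size_zip size_mkseq sw
  minnn.
have nE i : nth (0, 0)%N (zip (rank_word J) w) i = (nth 0%N (rank_word J) i,
  nth 0%N w i).
  by rewrite nth_zip // size_mkseq.
apply/(sortedP (0, 0)%N)/fintype.subsetP => H i.
  rewrite inE => wi; have := ltn_ord i => iN; have := H i.
  rewrite sz !nE rank_word_nth /lexle /= => /(_ ltac:(lia)).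
  by case: (i \in J) => //; lia.
rewrite sz !nE => iN; have iN' : (i < n.-1)%N by lia.
have := H (Ordinal iN'); rewrite inE (rank_word_nth J (Ordinal iN')) /lexle /=.
by case: (_ \in J) => H'; [lia|case: ltnP H' => [_ /(_ isT) //|le _]; lia].
Qed.

Definition perm_word n (pi : 'S_n) : seq nat := [seq val (pi i) | i <- enum
  'I_n].

Lemma size_perm_word n (pi : 'S_n) : size (perm_word pi) = n.
Proof. by rewrite size_map size_enum_ord. Qed.

Lemma nth_perm_word n (pi : 'S_n) (i : 'I_n) : nth 0%N (perm_word pi) i = pi i.
Proof. by rewrite (nth_map i) ?size_enum_ord // nth_ord_enum. Qed.

Lemma perm_word_inj n : injective (@perm_word n).
Proof.
move=> p q e; apply/permP => i; apply: val_inj.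
by rewrite /= -!nth_perm_word e.
Qed.

Lemma perm_words n :
  perm_eq [seq perm_word pi | pi <- enum 'S_n] (permutations (iota 0 n)).
Proof.
have u : uniq [seq perm_word pi | pi <- enum 'S_n].
  by rewrite map_inj_uniq ?enum_uniq //; apply: perm_word_inj.
have sub : {subset [seq perm_word pi | pi <- enum 'S_n] <= permutations (iota 0
  n)}.
  move=> _ /mapP[pi _ ->]; rewrite mem_permutations -val_enum_ord /perm_word.
  rewrite (map_comp val pi); apply: perm_map; apply: uniq_perm.
  - by rewrite map_inj_uniq ?enum_uniq //; apply: perm_inj.
  - exact: enum_uniq.
  - move=> i; rewrite !mem_enum; apply/mapP; exists ((pi^-1)%g i).
      by rewrite mem_enum.
    by rewrite permKV.
apply: uniq_perm; rewrite ?permutations_uniq //.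
have [//|_ e] := uniq_min_size u sub; last exact: e.
rewrite size_permutations ?iota_uniq // size_iota size_map -cardE.
by rewrite card_Sn.
Qed.

Lemma count_perm_words n (P : pred (seq nat)) :
  count P (permutations (iota 0 n)) = #|[set pi : 'S_n | P (perm_word pi)]%SET|.
Proof.
rewrite -(seq.permP (perm_words n)) count_map cardE -size_filter.
apply/perm_size/uniq_perm => [||pi].
- exact/filter_uniq/enum_uniq.
- exact: enum_uniq.
by rewrite mem_filter !mem_enum !inE andbT.
Qed.

Lemma avoidsE k n (pi : 'S_n) : (0 < k)%N ->
  avoids k pi = avoidw k (perm_word pi).
Proof.
move=> k0; apply/forallP/avoidwP; rewrite size_perm_word => H i.
  move=> ik; have iN : (i < n)%N by lia.
  by have := H (Ordinal iN); rewrite ik.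
by apply/implyP => ik; apply: H.
Qed.

Lemma avoidw_expansion k n : (1 < k)%N -> (0 < n)%N ->
  exists2 E : seq (rat * seq nat),
    all (fun p => (size p.2 == n) && sorted leq p.2) E
  & forall w, ((size w == n) && avoidw k w)%:R = \sum_(p <- E) p.1 * (biw p.2
    w)%:R.
Proof.
move=> k1 n0.
have [eps eE] := moebius_sets (fun D : {set 'I_n.-1} =>
  ((~: D)%SET \in gset k n)%:R).
exists [seq (eps J, rank_word J) | J <- index_enum {set 'I_n.-1}].
  by rewrite all_map; apply/allP => J _ /=;
    rewrite size_mkseq eqxx rank_word_sorted.
move=> w; rewrite big_map /=; under eq_bigr do rewrite biw_rank_word.
case: (eqVneq (size w) n) => [sw|_]; last by rewrite big1 // => J _;
  rewrite mulr0.
have <- : ((~: descents n w)%SET \in gset k n) = avoidw k w.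
  by move: n0; rewrite -sw; apply: gset_descents.
exact: eE.
Qed.

(** The indicator of avoidance is a combination of conditions biw l; on the
    left, the condition biw l selects the permutations counted by the hypothesis
    on f, and on the right it contributes the coefficient of f at l. *)
Lemma hall_gtilde k n f (P : pred 'S_n) : (1 < k)%N -> (0 < n)%N -> hspan n f ->
  (forall l, size l = n -> sorted leq l ->
     f (seq_mset l) = #|[set pi : 'S_n | P pi && biw l (perm_word pi)]%SET|%:R)
       ->
  #|[set pi : 'S_n | avoids k pi && P pi]%SET|%:R = hall f (gtilde k n).
Proof.
move=> k1 n0 hf fE; have [E EP wE] := avoidw_expansion k1 n0.
have -> : gtilde k n = \sum_(p <- E) p.1 *: wsum (fun w => (biw p.2 w)%:R).
  rewrite gtildeE //; under eq_bigr do rewrite wsumZ; rewrite wsum_sum.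
  exact: eq_wsum.
rewrite (hallE n0 hf EP).
have cE (A : pred 'S_n) : #|[set pi : 'S_n | A pi]%SET|%:R = \sum_pi (A pi)%:R
  :> rat.
  rewrite -sum1_card natr_sum big_mkcond; apply: eq_bigr => pi _.
  by rewrite inE; case: (A pi).
transitivity (\sum_(p <- E) p.1 * \sum_(pi : 'S_n) (P pi && biw p.2 (perm_word
  pi))%:R).
  under [RHS]eq_bigr do rewrite mulr_sumr.
  rewrite exchange_big cE; apply: eq_bigr => pi _ /=.
  rewrite avoidsE; last by lia.
  have := wE (perm_word pi); rewrite size_perm_word eqxx andTb => e.
  rewrite natr_andb e mulr_suml; apply: eq_bigr => p _.
  by rewrite natr_andb mulrAC mulrA.
rewrite !big_seq; apply: eq_bigr => p /(allP EP) /andP[/eqP sp1 sp2].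
by rewrite fE // cE.
Qed.

(** * Lyndon words *)

Notation word_le u v := (word_ge v u).

Lemma wlt_nil v : word_lt [::] v = (v != [::]).
Proof. by case: v. Qed.

Lemma wlt_cons a u b v :
  word_lt (a :: u) (b :: v) = (a < b)%N || (a == b) && word_lt u v.
Proof.
rewrite /word_lt ltxi_cons !leEnat; by case: (ltngtP a b).
Qed.

Lemma wlt_irr u : word_lt u u = false. Proof. exact: ltxx. Qed.

Lemma wlt_trans : transitive word_lt.
Proof. by move=> v u w; rewrite /word_lt; apply: lt_trans. Qed.

Lemma wle_trans u v w : word_le u v -> word_le v w -> word_le u w.
Proof. by rewrite /word_ge; apply: le_trans. Qed.

Lemma wltNge u v : word_lt u v = ~~ word_le v u. Proof. exact: ltNge. Qed.

Lemma wle_eqVlt u v : word_le u v = (u == v) || word_lt u v.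
Proof. exact: le_eqVlt. Qed.

Lemma wge_total : total word_ge. Proof.
by move=> u v; rewrite /word_ge; apply: le_total. Qed.
Lemma wge_trans : transitive word_ge.
Proof. by move=> u v w /= vu wv; rewrite /word_ge in vu wv *;
  apply: le_trans wv vu. Qed.
Lemma wge_anti : antisymmetric word_ge.
Proof. by move=> u v; rewrite andbC /word_ge => /le_anti. Qed.

Lemma wlt_cat2l x u v : word_lt (x ++ u) (x ++ v) = word_lt u v.
Proof. by elim: x => //= a x IH; rewrite wlt_cons ltnn eqxx. Qed.

(** In the second case the words differ at some letter, which decides the
    comparison of all their extensions. *)
Lemma wlt_cases u v : word_lt u v ->
  (exists2 x, x <> [::] & v = u ++ x) \/
  (forall y z, word_lt (u ++ y) (v ++ z)).
Proof.
elim: u v => [|a u IH] [|b v] //.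
  by move=> _; left; exists (b :: v).
rewrite wlt_cons => /orP[ab|/andP[/eqP <- /IH[[x x0 ->]|H]]].
- by right=> y z; rewrite wlt_cons ab.
- by left; exists x.
- by right=> y z; rewrite wlt_cons eqxx H orbT.
Qed.

Lemma min_suffix w : w <> [::] -> exists x v,
  [/\ w = x ++ v, v <> [::]
    & forall y z, w = y ++ z -> z <> [::] -> word_le v z].
Proof.
elim: w => // a [|b t] IH _.
  exists [::], [:: a]; split=> // -[|c y] z /=; first by move=> <- _;
    exact: lexx.
  by case: y z => [|? ?] [|? ?].
have [//|x [v [tE v0 vmin]]] := IH.
case: (boolP (word_le (a :: b :: t) v)) => H.
  exists [::], (a :: b :: t); split=> // -[|c y] z /=; first by move=> <- _;
    exact: lexx.
  by move=> [_ /vmin vz] /vz; apply: wle_trans.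
exists (a :: x), v; split=> //=; first by rewrite tE.
move=> [|c y] z /=; last by move=> [_ /vmin].
by move=> <- _; apply: ltW; have := H; rewrite -wltNge.
Qed.

Lemma min_suffix_lyndon v : v <> [::] ->
  (forall y z, v = y ++ z -> z <> [::] -> word_le v z) -> lyndon v.
Proof.
move=> v0 vmin; split=> // x y x0 y0 vE.
have : word_lt v y.
  have := vmin x y vE y0; rewrite wle_eqVlt => /orP[/eqP e|//].
  by move/(congr1 size): vE; rewrite e size_cat; case: x x0 => //=; lia.
move=> /wlt_cases[[z _ e]|]; last by move=> /(_ [::] x); rewrite cats0.
by move/(congr1 size): vE; rewrite e !size_cat; case: x x0 => //=; lia.
Qed.

(** Split off the least suffix v of w. If the last factor v' of what remains
    were less than v, then v' v would be a suffix less than v, or v = v' x with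
    x < v. *)
Lemma lyndon_factorization w : exists us : seq (seq nat),
  [/\ w = flatten us, forall u, u \in us -> lyndon u & sorted word_ge us].
Proof.
have [n] := ubnP (size w); elim: n w => // n IH w wn.
case: (eqVneq w [::]) => [->|/eqP w0]; first by exists [::].
have [x [v [wE v0 vmin]]] := min_suffix w0.
have vL : lyndon v.
  apply: min_suffix_lyndon => // y z vE z0; apply: (vmin (x ++ y)) => //.
  by rewrite wE vE catA.
have [|us [xE usL uss]] := IH x.
  by move: wn; rewrite wE size_cat; case: v v0 {wE vmin vL} => //=; lia.
exists (rcons us v); split.
- by rewrite flatten_rcons -xE.
- by move=> u; rewrite mem_rcons inE => /orP[/eqP ->|/usL].
case/lastP: us xE usL uss => [//|us v'] xE usL uss.
have v'L : lyndon v' by apply: usL; rewrite mem_rcons mem_head.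
suff vv' : word_ge v' v.
  move: uss; rewrite !(sorted_pairwise wge_trans) -(cats1 (rcons us v'))
    pairwise_cat.
  move=> us1; rewrite us1 /= andbT allrel1r.
  rewrite all_rcons vv' /=; move: us1; rewrite -cats1 pairwise_cat allrel1r.
  by case/and3P=> /allP le _ _; apply/allP => u /le /= uv;
    apply: wge_trans uv vv'.
rewrite -[word_ge _ _]negbK -wltNge; apply/negP => lt.
have le : word_le v (v' ++ v).
  apply: (vmin (flatten us)); last by case: (v') v'L.1.
  by rewrite wE xE flatten_rcons catA.
case: (wlt_cases lt) => [[z z0 vE]|H].
  have : word_lt z v.
    move: le; rewrite {2}vE wle_eqVlt wlt_cat2l => /orP[/eqP|//].
    move/(congr1 size)/eqP; rewrite !size_cat eqn_add2l vE size_cat.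
    by case: (v') v'L.1 => //= a l _; lia.
  rewrite wltNge => /negP; apply; apply: (vmin (x ++ v')) => //.
  by rewrite wE {1}vE catA.
have := H v [::]; rewrite cats0 wltNge => /negP; apply; exact: le.
Qed.

(** * From Lyndon factorizations to permutations *)

Lemma rotE (u : seq nat) c : (c <= size u)%N ->
  rot c u = mkseq (fun t => nth 0%N u ((c + t) %% size u)) (size u).
Proof.
move=> cs; apply: (@eq_from_nth _ 0%N); first by rewrite size_rot size_mkseq.
move=> t; rewrite size_rot => ts;
  rewrite nth_mkseq // /rot nth_cat size_drop nth_drop.
case: ltnP => h; first by rewrite modn_small //; lia.
rewrite nth_take; last by lia.
have -> : (c + t = (t - (size u - c)) + size u)%N by lia.
by rewrite modnDr modn_small //; lia.
Qed.

Lemma lyndon_rot u c : lyndon u -> (0 < c < size u)%N -> word_lt u (rot c u).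
Proof.
move=> [u0 H] cu; apply: H; last by rewrite cat_take_drop.
  by move/(congr1 size); rewrite size_takel /=; lia.
by move/(congr1 size); rewrite size_drop /=; lia.
Qed.

Lemma lyndon_rot_eq u x c : lyndon u -> lyndon x -> rot c u = x ->
  (c < size u)%N ->
  c = 0%N.
Proof.
move=> uL xL rE cu; case: (posnP c) => // c0.
have lt : word_lt u x by rewrite -rE; apply: lyndon_rot; rewrite ?c0.
have : word_lt x u.
  have -> : u = rot (size u - c) x.
    by rewrite -rE -{1}(rotK c u) /rotr size_rot.
  by apply: lyndon_rot; rewrite // -rE size_rot; lia.
by move=> /(wlt_trans lt); rewrite wlt_irr.
Qed.

(** A position is the index of a word in the list and an offset in that word. *)
Definition positions (us : seq (seq nat)) : seq (nat * nat) :=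
  [seq (r, c) | r <- iota 0 (size us), c <- iota 0 (size (nth [::] us r))].

Definition letter (us : seq (seq nat)) (p : nat * nat) : nat :=
  nth 0%N (nth [::] us p.1) p.2.

Definition next_pos (us : seq (seq nat)) (p : nat * nat) : nat * nat :=
  (p.1, p.2.+1 %% size (nth [::] us p.1))%N.

Lemma mem_positions us p : (p \in positions us) =
  (p.1 < size us)%N && (p.2 < size (nth [::] us p.1))%N.
Proof.
apply/allpairsPdep/andP => [[r [c [+ + ->]]]|[r0 c0]].
  by rewrite !mem_iota.
by case: p r0 c0 => r c r0 c0; exists r, c; rewrite !mem_iota.
Qed.

Lemma positions_uniq us : uniq (positions us).
Proof.
apply: allpairs_uniq_dep => [|r _|[r c] [r' c'] _ _ [-> ->] //];
  exact: iota_uniq.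
Qed.

Lemma map_letter_positions us : map (letter us) (positions us) = flatten us.
Proof.
rewrite /positions map_flatten -map_comp -[in RHS](mkseq_nth [::] us).
congr flatten; apply: eq_map => r /=; rewrite -map_comp.
exact: (mkseq_nth 0%N (nth [::] us r)).
Qed.

Lemma size_positions us : size (positions us) = size (flatten us).
Proof. by rewrite -map_letter_positions size_map. Qed.

Lemma count_positions us (P : pred (nat * nat)) :
  count P (positions us) =
  (\sum_(r <- iota 0 (size us))
     count (fun c => P (r, c)) (iota 0 (size (nth [::] us r))))%N.
Proof.
rewrite /positions count_flatten sumnE !big_map; apply: eq_bigr => r _.
by rewrite count_map.
Qed.

(** Here g i is the position of the point i in the words us, so that the cycles
    of pi, read through the letters l, are these words up to rotation. *)
Record cycles_read n (us : seq (seq nat)) (pi : 'S_n) (l : seq nat)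
    (g : 'I_n -> nat * nat) : Prop := CyclesRead {
  cr_perm : perm_eq [seq g i | i <- enum 'I_n] (positions us);
  cr_next : forall i, g (pi i) = next_pos us (g i);
  cr_letter : forall i : 'I_n, nth 0%N l i = letter us (g i)
}.

Definition cycle_word n (pi : 'S_n) (l : seq nat) (i : 'I_n) : seq nat :=
  [seq nth 0%N l (val j) | j <- traject pi i #|porbit pi i|].

Section CyclesRead.
Variables (n : nat) (us : seq (seq nat)) (pi : 'S_n) (l : seq nat).
Variable g : 'I_n -> nat * nat.
Hypothesis usL : forall u, u \in us -> lyndon u.
Hypothesis gP : cycles_read us pi l g.

Let s r := size (nth [::] us r).

Let gmem i : ((g i).1 < size us)%N /\ ((g i).2 < s (g i).1)%N.
Proof.
apply/andP; rewrite -mem_positions -(perm_mem (cr_perm gP)).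
by apply: map_f; rewrite mem_enum.
Qed.

Let gsurj p : p \in positions us -> exists i, g i = p.
Proof. by rewrite -(perm_mem (cr_perm gP)) => /mapP[i _ ->]; exists i. Qed.

Let ginj : injective g.
Proof.
have u : uniq [seq g i | i <- enum 'I_n].
  by rewrite (perm_uniq (cr_perm gP)) positions_uniq.
exact/injectiveP.
Qed.

Let s0 r : (r < size us)%N -> (0 < s r)%N.
Proof.
move=> rs; rewrite lt0n size_eq0; apply/eqP.
exact: (usL (mem_nth [::] rs)).1.
Qed.

Let gX i t : g (iter t pi i) = ((g i).1, ((g i).2 + t) %% s (g i).1)%N.
Proof.
elim: t => [|t IH] /=.
  by rewrite addn0 modn_small ?(gmem i).2 //; case: (g i).
by rewrite (cr_next gP) IH /next_pos /= -/(s _) -addn1 modnDml addn1 addnS.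
Qed.

Let porbitE i : porbit pi i = [set j | (g j).1 == (g i).1]%SET.
Proof.
apply/setP => j; rewrite inE; apply/porbitP/eqP => [[t ->]|gij].
  by rewrite permX gX.
exists ((g j).2 + (s (g i).1 - (g i).2))%N; rewrite permX; apply: ginj.
rewrite gX [LHS]surjective_pairing gij; congr (_, _).
have [_ h] := gmem i; have [_] := gmem j; rewrite gij => h'.
have -> : ((g i).2 + ((g j).2 + (s (g i).1 - (g i).2)) = (g j).2 + s (g i).1)%N
  by lia.
by rewrite modnDr modn_small.
Qed.

Let card_block r : (r < size us)%N -> #|[set j | (g j).1 == r]%SET| = s r.
Proof.
move=> rs; rewrite cardsE cardE size_filter.
rewrite [LHS](_ : _ = count (fun p => p.1 == r) [seq g i | i <- enum 'I_n]);
  last first.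
  by rewrite count_map enumT.
rewrite (seq.permP (cr_perm gP)) count_positions (bigD1_seq r) ?iota_uniq
  ?mem_iota //=.
rewrite big1 ?addn0 => [|r' /negPf r'r]; last first.
  by rewrite (eq_count (a2 := pred0)) ?count_pred0 // => c /=; rewrite r'r.
by rewrite (eq_count (a2 := predT)) ?count_predT ?size_iota ?addn0 // => c /=;
  rewrite eqxx.
Qed.

Lemma cycle_type_cycles_read : cycle_type pi = sort geq (map size us).
Proof.
have -> : map size us = map s (iota 0 (size us)).
  by rewrite -[in LHS](mkseq_nth [::] us) -map_comp.
pose B r := [set j | (g j).1 == r]%SET.
have -> : map s (iota 0 (size us)) = map (fun C : {set 'I_n} =>
  #|C|) (map B (iota 0 (size us))).
  rewrite -map_comp; apply/eq_in_map => r; rewrite mem_iota => /andP[_ rs] /=.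
  by rewrite card_block.
rewrite /cycle_type; apply/(perm_sortP geq_total geq_trans geq_anti)/perm_map.
apply: uniq_perm; first exact: enum_uniq.
  rewrite map_inj_in_uniq ?iota_uniq // => r r';
    rewrite !mem_iota => /andP[_ rs] _ BB.
  have [|j gj] := gsurj (p := (r, 0%N));
    first by rewrite mem_positions /= rs s0.
  have : j \in B r by rewrite inE gj.
  by rewrite BB inE gj => /eqP.
move=> C; rewrite mem_enum; apply/imsetP/mapP => [[i _ ->]|[r]].
  by exists (g i).1; rewrite ?porbitE // mem_iota (gmem i).1.
rewrite mem_iota => /andP[_ rs] ->.
have [|j gj] := gsurj (p := (r, 0%N)); first by rewrite mem_positions /= rs s0.
by exists j; rewrite // porbitE gj.
Qed.

Let cycle_wordE i : cycle_word pi l i = rot (g i).2 (nth [::] us (g i).1).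
Proof.
have [h1 h2] := gmem i.
rewrite rotE ?(ltnW h2) // /cycle_word porbitE card_block //.
apply: (@eq_from_nth _ 0%N); first by rewrite !size_map size_traject size_iota.
move=> t; rewrite size_map size_traject => ts.
rewrite (nth_map i) ?size_traject // nth_traject // nth_mkseq //.
by rewrite (cr_letter gP) gX.
Qed.

(** Exactly one starting point on the cycle of a Lyndon word reads a Lyndon
    word. *)
Lemma count_cycle_word x : lyndon x ->
  count_mem x us = #|[set i | cycle_word pi l i == x]%SET|.
Proof.
move=> xL; rewrite cardsE cardE size_filter.
rewrite [RHS](_ : _ = count (fun p =>
  rot p.2 (nth [::] us p.1) == x) [seq g i | i <- enum 'I_n]).
  rewrite (seq.permP (cr_perm gP)) count_positions -sum1_count -[in
    LHS](mkseq_nth [::] us).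
  rewrite big_map big_mkcond /= !big_seq; apply: eq_bigr => r;
    rewrite mem_iota => /andP[_ rs].
  have uL : lyndon (nth [::] us r) by apply/usL/mem_nth.
  rewrite (eq_in_count (a2 := fun c =>
    (c == 0%N) && (nth [::] us r == x))) => [|c].
    case: (nth [::] us r == x).
      rewrite (eq_count (a2 := pred1 0%N)); last by move=> c /=; rewrite andbT.
      by rewrite count_uniq_mem ?iota_uniq // mem_iota s0.
    by rewrite (eq_count (a2 := pred0)) ?count_pred0 // => c /=; rewrite andbF.
  rewrite mem_iota => /andP[_ cs] /=; apply/eqP/andP => [e|[/eqP -> /eqP <-]].
    have c0 := lyndon_rot_eq uL xL e cs.
    by move: e; rewrite c0 rot0 => ->.
  by rewrite rot0.
by rewrite count_map enumT; apply: eq_count => i; rewrite /= -cycle_wordE.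
Qed.

End CyclesRead.

(** Both lists consist of the Lyndon words that are read along the cycles, in
    decreasing order. *)
Lemma cycles_read_inj n us us' (pi : 'S_n) l g g' :
  (forall u, u \in us -> lyndon u) -> (forall u, u \in us' -> lyndon u) ->
  sorted word_ge us -> sorted word_ge us' ->
  cycles_read us pi l g -> cycles_read us' pi l g' -> us = us'.
Proof.
move=> L L' su su' c c'; apply: (sorted_eq wge_trans wge_anti) => //.
apply/allP => x; rewrite mem_cat => xus /=; apply/eqP.
have xL : lyndon x by case/orP: xus => [/L|/L'].
by rewrite (count_cycle_word L c xL) (count_cycle_word L' c' xL).
Qed.

(** * The Gessel-Reutenauer correspondence *)

Section Construction.
Variable us : seq (seq nat).
Hypothesis usL : forall u, u \in us -> lyndon u.
Let n := size (flatten us).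
Let s r := size (nth [::] us r).

(** A common multiple of the lengths of the words of us, which are at most n: a
    periodic word is determined by its first N letters, and passing to the next
    position rotates these. *)
Let N := n`!.

Definition periodic_word (p : nat * nat) : seq nat :=
  mkseq (fun t => letter us (p.1, (p.2 + t) %% size (nth [::] us p.1))%N) N.

Definition pos_le : rel (nat * nat) := fun p q =>
  word_lt (periodic_word p) (periodic_word q) ||
  (periodic_word p == periodic_word q) && (p.1 <= q.1)%N.

Lemma pos_le_trans : transitive pos_le.
Proof.
move=> q p r; rewrite /pos_le =>
  /orP[pq|/andP[/eqP -> pq]] /orP[qr|/andP[/eqP <- qr]].
- by rewrite (wlt_trans pq qr).
- by rewrite pq.
- by rewrite qr.
- by rewrite eqxx (leq_trans pq qr) orbT.
Qed.

Lemma pos_le_total : total pos_le.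
Proof.
move=> p q; rewrite /pos_le.
case/orP: (wge_total (periodic_word p) (periodic_word q));
  rewrite wle_eqVlt => /orP[/eqP ->|->]; rewrite ?orbT // eqxx wlt_irr.
all: exact: leq_total.
Qed.

Let sN r : (r < size us)%N -> (0 < s r)%N /\ (s r %| N)%N.
Proof.
move=> rs; have rm := mem_nth [::] rs.
have s0 : (0 < s r)%N by rewrite lt0n size_eq0; apply/eqP; exact: (usL rm).1.
split=> //; apply: dvdn_fact; rewrite s0 /n /s.
elim: us (nth [::] us r) rm => //= v vs IH u.
rewrite size_cat inE => /orP[/eqP ->|/IH h]; first exact: leq_addr.
exact: leq_trans h (leq_addl _ _).
Qed.

Let N0 : (0 < N)%N. Proof. exact: fact_gt0. Qed.

Lemma periodic_word_next p : p \in positions us ->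
  periodic_word p = letter us p :: behead (periodic_word p) /\
  periodic_word (next_pos us p) = rcons (behead (periodic_word p)) (letter us
    p).
Proof.
rewrite mem_positions => /andP[p1 p2]; have [s0 sd] := sN p1.
have E0 : (p.1, p.2 %% s p.1)%N = p by rewrite modn_small //
  -surjective_pairing.
split; first by rewrite /periodic_word /mkseq -(prednK N0) /= addn0 -/(s _) E0.
have -> : letter us p = letter us (p.1, p.2 %% s p.1)%N by rewrite E0.
apply: (@eq_from_nth _ 0%N).
  by rewrite size_rcons size_behead !size_mkseq prednK.
move=> t; rewrite size_mkseq => tN.
rewrite nth_mkseq // nth_rcons size_behead size_mkseq nth_behead -/(s _).
rewrite modnDml addSnnS; case: ltngtP => h; last 1 first.
- by rewrite h prednK // -(divnK sd) addnC modnMDl.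
- by rewrite nth_mkseq //; lia.
- by lia.
Qed.

Lemma size_periodic_word p : size (periodic_word p) = N.
Proof. by rewrite size_mkseq. Qed.

Lemma word_lt_rcons a x y : size x = size y -> word_lt x y ->
  word_lt (rcons x a) (rcons y a).
Proof.
move=> sxy /wlt_cases[[z z0 e]|]; last by rewrite -!cats1; apply.
by move/eqP: sxy; rewrite e size_cat; case: z z0 {e} => //= ? ?; lia.
Qed.

Lemma pos_le_letter p q : p \in positions us -> q \in positions us ->
  pos_le p q -> (letter us p <= letter us q)%N.
Proof.
move=> /periodic_word_next[pE _] /periodic_word_next[qE _].
rewrite /pos_le pE qE wlt_cons eqseq_cons => /orP[/orP[/ltnW //|]|].
  by move=> /andP[/eqP ->].
by move=> /andP[/andP[/eqP ->]].
Qed.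

Lemma pos_le_next p q : p \in positions us -> q \in positions us ->
  letter us p = letter us q -> pos_le p q ->
    pos_le (next_pos us p) (next_pos us q).
Proof.
move=> pP qP e.
have [pE pN] := periodic_word_next pP; have [qE qN] := periodic_word_next qP.
rewrite /pos_le pN qN pE qE wlt_cons eqseq_cons e ltnn eqxx /=.
move=> /orP[lt|/andP[/eqP -> ->]]; last by rewrite eqxx orbT.
by rewrite word_lt_rcons // !size_behead !size_periodic_word.
Qed.

(** Two different positions with the same periodic word lie in different words,
    because a Lyndon word differs from its proper rotations. *)
Lemma pos_le_anti : {in positions us &, antisymmetric pos_le}.
Proof.
move=> [r c] [r' c']; rewrite !mem_positions /= => /andP[rs cs] /andP[r's c's].
rewrite /pos_le /= => H.
have [e rr] : periodic_word (r, c) = periodic_word (r', c') /\ r = r'.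
  move: H => /andP[/orP[lt|/andP[/eqP e le]] /orP[lt'|/andP[/eqP e' le']]].
  - by move: (wlt_trans lt lt'); rewrite wlt_irr.
  - by move: lt; rewrite e' wlt_irr.
  - by move: lt'; rewrite e wlt_irr.
  - by split=> //; apply/eqP; rewrite eqn_leq le.
subst r'; congr (_, _).
have [s0 sd] := sN rs; have uL := usL (mem_nth [::] rs).
have rE : rot c (nth [::] us r) = rot c' (nth [::] us r).
  rewrite !rotE ?(ltnW cs) ?(ltnW c's) //.
  apply: (@eq_from_nth _ 0%N); first by rewrite !size_mkseq.
  move=> t; rewrite size_mkseq => ts.
  have tN : (t < N)%N by apply: leq_trans ts (dvdn_leq N0 sd).
  move/(congr1 (fun w => nth 0%N w t)): e.
  by rewrite /periodic_word !nth_mkseq.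
have lt_absurd a b : rot a (nth [::] us r) = rot b (nth [::] us r) ->
    (a < b)%N -> (b < s r)%N -> False.
  move=> ab lt bs.
  have /lyndon_rot - /(_ uL) : (0 < b - a < s r)%N by lia.
  have -> : rot (b - a) (nth [::] us r) = nth [::] us r.
    apply: (@rot_inj a); rewrite -rotD ?subnKC ?(ltnW lt) //.
    exact: ltnW.
  by rewrite wlt_irr.
case: (ltngtP c c') => // h; exfalso; [exact: lt_absurd rE h c's|].
exact: lt_absurd (esym rE) h cs.
Qed.

Let PS := sort pos_le (positions us).

Let PSperm : perm_eq PS (positions us). Proof. by rewrite perm_sort. Qed.

Let PSsize : size PS = n. Proof. by rewrite size_sort size_positions. Qed.

Let PSuniq : uniq PS. Proof. by rewrite sort_uniq positions_uniq. Qed.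

Let PSsorted : sorted pos_le PS. Proof. exact: sort_sorted pos_le_total _. Qed.

Let next_mem p : p \in positions us -> next_pos us p \in positions us.
Proof.
rewrite !mem_positions /= => /andP[p1 p2]; rewrite p1 ltn_mod.
by have [] := sN p1.
Qed.

Let next_inj : {in positions us &, injective (next_pos us)}.
Proof.
move=> [r c] [r' c']; rewrite !mem_positions /= => /andP[rs cs] /andP[r's c's].
rewrite /next_pos /= => -[rr]; subst r'; rewrite -/(s r) in cs c's * => cc.
congr (_, _); move: cc.
have mE d : (d < s r)%N -> (d.+1 %% s r = if d.+1 == s r then 0 else d.+1)%N.
  by move=> ds; case: eqP => [->|e]; rewrite ?modnn // modn_small //; lia.
by rewrite !mE //; case: eqP => [e|_]; case: eqP => [e'|_] //; lia.
Qed.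

Let step (i : 'I_n) : 'I_n := insubd i (index (next_pos us (nth (0,
  0)%N PS i)) PS).

Let nth_mem i : (i < n)%N -> nth (0, 0)%N PS i \in positions us.
Proof. by move=> iN; rewrite -(perm_mem PSperm) mem_nth ?PSsize. Qed.

Let stepE i : nth (0, 0)%N PS (step i) = next_pos us (nth (0, 0)%N PS i).
Proof.
have mP : next_pos us (nth (0, 0)%N PS i) \in PS.
  by rewrite (perm_mem PSperm) next_mem // nth_mem.
have lt : (index (next_pos us (nth (0, 0)%N PS i)) PS < n)%N.
  by have := mP; rewrite -index_mem PSsize.
by rewrite /step val_insubd lt nth_index.
Qed.

Let step_inj : injective step.
Proof.
move=> i j /(congr1 (fun k : 'I_n => nth (0, 0)%N PS k)); rewrite !stepE.
move=> /next_inj => /(_ (nth_mem (ltn_ord i)) (nth_mem (ltn_ord j))) /eqP.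
by rewrite nth_uniq ?PSsize // => /eqP /val_inj.
Qed.

(** Sort the positions by the infinite periodic words that start there, equal
    words being told apart by the index of the factor; the successor of a
    position in its factor then becomes a permutation of ranks. Equal first
    letters are compared by what follows, so this permutation increases where
    the sorted letters are equal. *)
Lemma lyndon_cycles l : sorted leq l -> perm_eq (flatten us) l ->
  exists (pi : 'S_(size (flatten us))) g,
    cycles_read us pi l g /\ biw l (perm_word pi).
Proof.
move=> sl ul.
have lE : l = map (letter us) PS.
  apply: (sorted_eq leq_trans anti_leq) => //.
    rewrite sorted_map; move: PSsorted;
      apply: (sub_in_sorted (P := mem (positions us))).
      exact: pos_le_letter.
    by apply/allP => p; rewrite (perm_mem PSperm).
  rewrite perm_sym (perm_trans _ ul) // -map_letter_positions.
  exact: perm_map.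
pose pi : 'S_n := perm step_inj.
have piE i : nth (0, 0)%N PS (pi i) = next_pos us (nth (0, 0)%N PS i).
  by rewrite permE stepE.
have lN (i : 'I_n) : nth 0%N l i = letter us (nth (0, 0)%N PS i).
  by rewrite lE (nth_map (0, 0)%N) // PSsize.
exists pi, (fun i => nth (0, 0)%N PS i); split.
  split=> //; rewrite -(perm_rot 0) rot0 (perm_trans _ PSperm) //.
  rewrite -[X in perm_eq _ X](mkseq_nth (0, 0)%N) /mkseq PSsize -val_enum_ord.
  by rewrite -map_comp.
have sln : size l = n by rewrite lE size_map.
rewrite /biw size_perm_word sln eqxx /=; apply/(sortedP (0, 0)%N) => i.
rewrite size_zip size_perm_word sln minnn => iN.
rewrite !nth_zip ?size_perm_word ?sln //.
have iN' : (i < n)%N by apply: ltnW.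
pose a := Ordinal iN'; pose b := Ordinal iN.
rewrite -[i]/(val a) -[(val a).+1]/(val b) !nth_perm_word !lN.
have ab : pos_le (nth (0, 0)%N PS a) (nth (0, 0)%N PS b).
  by apply: (sortedP _ PSsorted); rewrite PSsize.
have aP := nth_mem (ltn_ord a); have bP := nth_mem (ltn_ord b).
have le := pos_le_letter aP bP ab.
rewrite /lexle /=; case: ltngtP le => //= e _.
have := pos_le_next aP bP e ab; rewrite -!piE => ab'.
rewrite leqNgt; apply/negP => lt.
have ba' : pos_le (nth (0, 0)%N PS (pi b)) (nth (0, 0)%N PS (pi a)).
  have := sorted_leq_nth pos_le_trans _ (0, 0)%N PSsorted; apply;
    rewrite ?inE ?PSsize //.
    by move=> p; rewrite /pos_le eqxx leqnn orbT.
  exact: ltnW.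
have /eqP := pos_le_anti (nth_mem (ltn_ord (pi a))) (nth_mem (ltn_ord (pi b)))
  (introT andP (conj ab' ba')).
by rewrite nth_uniq ?PSsize // => /eqP e'; move: lt; rewrite e' ltnn.
Qed.

End Construction.

Lemma word_type_part w lam : word_type w lam -> part_of (size w) lam.
Proof.
move=> [us [-> usL _ ->]]; apply: part_of_sort; last by rewrite size_flatten.
by apply/negP => /mapP[u /usL [u0 _]] /esym/size0nil.
Qed.

(** Each word of type lam gives a permutation of cycle type lam, whose cycles,
    read through l, give back its Lyndon factors. *)
Lemma leq_word_type l lam : sorted leq l ->
  (count (fun w => `[< word_type w lam >]) (permutations l) <=
   #|[set pi : 'S_(size l) | (cycle_type pi == lam) && biw l (perm_word
     pi)]%SET|)%N.
Proof.
move=> sl; set n := size l; rewrite -size_filter.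
pose R w (pi : 'S_n) := exists us g, [/\ w = flatten us,
  forall u, u \in us -> lyndon u, sorted word_ge us & cycles_read us pi l g].
have RP w : exists pi : 'S_n,
    w \in [seq w <- permutations l | `[< word_type w lam >]] ->
    [/\ R w pi, cycle_type pi = lam & biw l (perm_word pi)].
  case: (boolP (w \in _)) => [|_]; last by exists 1%g.
  rewrite mem_filter mem_permutations =>
    /andP[/asboolP[us [wE usL uss lamE]] wl].
  have [|pi [g]] := @lyndon_cycles us usL l sl; first by rewrite -wE.
  have e : size (flatten us) = n by rewrite -wE (perm_size wl).
  move: pi g; rewrite e => pi g [cr bi]; exists pi => _; split=> //.
    by exists us, g.
  by rewrite (cycle_type_cycles_read usL cr).
have [f fP] := choice RP.
rewrite cardE; apply: (@leq_size_inj _ _ f).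
- by rewrite filter_uniq ?permutations_uniq.
- move=> w w' /fP[[us [g [-> L S c]]] _ _] /fP[[us' [g' [-> L' S' c']]] _ _] e.
  by rewrite e in c; rewrite (cycles_read_inj L L' S S' c c').
- by move=> w /fP[_ ct bi]; rewrite mem_enum inE ct eqxx.
Qed.

(** The inequalities between the numbers of words and of permutations of each
    type are equalities, because both numbers sum to the number of words. *)
Theorem gessel_reutenauer l lam : sorted leq l -> part_of (size l) lam ->
  count (fun w => `[< word_type w lam >]) (permutations l) =
  #|[set pi : 'S_(size l) | (cycle_type pi == lam) && biw l (perm_word
    pi)]%SET|.
Proof.
move=> sl; rewrite -mem_partitions => lamP.
pose A nu := count (fun w => `[< word_type w nu >]) (permutations l).
pose B nu := #|[set pi : 'S_(size l) | (cycle_type pi == nu) && biw l (perm_word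
  pi)]%SET|.
have AB nu : (A nu <= B nu)%N by exact: leq_word_type.
suff BA : (\sum_(nu <- partitions (size l)) B nu <= \sum_(nu <- partitions (size
  l)) A nu)%N.
  move: BA; rewrite !(bigD1_seq lam) ?partitions_uniq //=.
  have := AB lam; rewrite -/(A lam) -/(B lam).
  have : (\sum_(nu <- partitions (size l) | nu != lam) A nu <=
          \sum_(nu <- partitions (size l) | nu != lam) B nu)%N by apply:
            leq_sum.
  by lia.
apply: (@leq_trans (size (permutations l))).
  rewrite -count_words_biw // count_perm_words -sum1_card.
  under eq_bigr do rewrite /B -sum1_card big_mkcond /=.
  rewrite exchange_big /= [leqRHS]big_mkcond /=; apply: leq_sum => pi _.
  rewrite inE; case: (boolP (biw _ _)) => b; last first.
    by rewrite big1 // => nu _; rewrite inE (negPf b) andbF.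
  rewrite -big_mkcond /= sum1_count.
  rewrite (eq_count (a2 := pred1 (cycle_type pi))).
    by rewrite count_uniq_mem ?partitions_uniq //; case: (_ \in _).
  by move=> nu; rewrite /= inE b andbT eq_sym.
under eq_bigr do rewrite /A -sum1_count big_mkcond /=.
rewrite exchange_big /= -sum1_size big_seq [leqRHS]big_seq; apply: leq_sum => w.
rewrite mem_permutations => wl.
have [us [wE usL uss]] := lyndon_factorization w.
have wt : word_type w (sort geq (map size us)) by exists us.
rewrite -big_mkcond sum1_count -has_count; apply/hasP.
exists (sort geq (map size us)); last exact/asboolP.
by rewrite mem_partitions -(perm_size wl) word_type_part.
Qed.

(** * The symmetry of L *)

Lemma wlt_prefix u x : x <> [::] -> word_lt u (u ++ x).
Proof. by move=> x0; rewrite -{1}(cats0 u) wlt_cat2l wlt_nil; apply/eqP. Qed.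

Lemma wle_prefix u x : word_le u (u ++ x).
Proof.
case: x => [|a x]; first by rewrite cats0; exact: lexx.
by apply: ltW; apply: wlt_prefix.
Qed.

Lemma wlt_cat u v y z : size u = size v -> word_lt u v ->
  word_lt (u ++ y) (v ++ z).
Proof.
move=> suv /wlt_cases[[x x0 vE]|]; last by apply.
by move/eqP: suv; rewrite vE size_cat; case: x x0 {vE} => //= ? ?; lia.
Qed.

(** Suppose z <= v for v = y z. As v < z y, the word z is a prefix of v, so v =
    z x with x < y; as x and y have the same length, x z < y z = v, while v < x
    z. *)
Lemma lyndon_suffix v y z : lyndon v -> v = y ++ z -> y <> [::] -> z <> [::] ->
  word_lt v z.
Proof.
move=> [v0 H] vE y0 z0; rewrite wltNge; apply/negP.
rewrite wle_eqVlt => /orP[/eqP zv|].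
  by move/(congr1 size): vE; rewrite -zv size_cat; case: (y) y0 => //= ? ?; lia.
have vzy := H _ _ y0 z0 vE.
move=> /wlt_cases[[x x0 vE']|]; last first.
  move=> /(_ y [::]); rewrite cats0 => zyv.
  by move: (wlt_trans vzy zyv); rewrite wlt_irr.
have sxy : size x = size y.
  by have := congr1 size vE; rewrite vE' !size_cat; lia.
have xy : word_lt x y by move: vzy; rewrite vE' wlt_cat2l.
have := wlt_cat z z sxy xy; rewrite -vE => xzv.
by move: (wlt_trans xzv (H _ _ z0 x0 vE')); rewrite wlt_irr.
Qed.

Lemma suffix_flatten (us : seq (seq nat)) y z : flatten us = y ++ z ->
  z <> [::] ->
  exists u y' z' t, [/\ u \in us, u = y' ++ z', z' <> [::] & z = z' ++ t].
Proof.
elim: us y => [|u us IH] y /=; first by case: y z => [|? ?] [].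
case: (ltnP (size y) (size u)) => yu e z0.
  exists u, y, (drop (size y) u), (flatten us); split.
  - exact: mem_head.
  - rewrite -{1}(cat_take_drop (size y) u); congr (_ ++ _).
    move/(congr1 (take (size y))): e.
    by rewrite (take_size_cat (s1 := y)) // take_cat yu.
  - by move/(congr1 size); rewrite size_drop /=; lia.
  - move/(congr1 (drop (size y))): e.
    by rewrite (drop_size_cat (s1 := y)) // drop_cat yu.
have e' : flatten us = drop (size u) y ++ z.
  move/(congr1 (drop (size u))): e; rewrite drop_size_cat // drop_cat.
  case: ltngtP yu => // se _.
  by rewrite se subnn drop0 drop_size.
have [v [y' [z' [t [vus vE z'0 zE]]]]] := IH _ e' z0.
by exists v, y', z', t; rewrite inE vus orbT.
Qed.

Definition lyndon_factors (us : seq (seq nat)) (w : seq nat) : Prop :=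
  [/\ w = flatten us, forall u, u \in us -> lyndon u & sorted word_ge us].

(** The suffix z starts with a suffix of some factor u; that suffix is at least
    u, and u is at least the last factor. So the last factor is determined by
    the word. *)
Lemma last_factor_min us v y z : (forall u, u \in rcons us v -> lyndon u) ->
  sorted word_ge (rcons us v) -> flatten (rcons us v) = y ++ z -> z <> [::] ->
  word_le v z.
Proof.
move=> usL uss fE z0.
have [u [y' [z' [t [uP uE z'0 ->]]]]] := suffix_flatten fE z0.
apply: wle_trans (wle_prefix z' t).
have uz' : word_le u z'.
  case: (eqVneq y' [::]) => [e|/eqP y'0]; first by rewrite uE e; exact: lexx.
  by apply: ltW; apply: lyndon_suffix (usL _ uP) uE y'0 z'0.
apply: wle_trans uz'; move: uP; rewrite mem_rcons inE => /orP[/eqP ->|uP].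
  exact: lexx.
move: uss; rewrite (sorted_pairwise wge_trans) -cats1 pairwise_cat allrel1r.
by case/and3P=> /allP /(_ _ uP).
Qed.

Lemma lyndon_factors_uniq us us' w :
  lyndon_factors us w -> lyndon_factors us' w -> us = us'.
Proof.
elim/last_ind: us us' w => [|us v IH] us' w.
  case: us' => [//|u us'] [-> _ _] [/esym/(congr1 size) /= + L _].
  have [u0 _] := L u (mem_head _ _); rewrite size_cat.
  by case: u u0 {L} => //= ? ? _; lia.
case/lastP: us' => [|us' v'].
  move=> [-> L _] [/(congr1 size) + _ _].
  have [v0 _] : lyndon v by apply: L; rewrite mem_rcons mem_head.
  by rewrite flatten_rcons size_cat; case: v v0 {L} => //= ? ? _; lia.
move=> [wE L S] [wE' L' S'].
have [v0 _] : lyndon v by apply: L; rewrite mem_rcons mem_head.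
have [v'0 _] : lyndon v' by apply: L'; rewrite mem_rcons mem_head.
have vv' : v = v'.
  apply: wge_anti; rewrite (last_factor_min L' S' (y := flatten us)) //;
    last first.
    by rewrite -wE' wE flatten_rcons.
  by rewrite (last_factor_min L S (y := flatten us')) // -wE wE' flatten_rcons.
subst v'; congr rcons; apply: (IH us' (flatten us)).
  split=> //; first by move=> u uP; apply: L; rewrite mem_rcons inE uP orbT.
  move: S; rewrite !(sorted_pairwise wge_trans) -cats1 pairwise_cat.
  by case/and3P.
split.
- have := wE; rewrite wE' !flatten_rcons => /eqP; rewrite eqseq_cat; last first.
    have := congr1 size wE; rewrite wE' !flatten_rcons !size_cat => /eqP.
    by rewrite eqn_add2r => /eqP.
  by case/andP=> /eqP.
- by move=> u uP; apply: L'; rewrite mem_rcons inE uP orbT.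
- move: S'; rewrite !(sorted_pairwise wge_trans) -cats1 pairwise_cat.
  by case/and3P.
Qed.

Definition factors (w : seq nat) : seq (seq nat) :=
  xget [::] [set us | lyndon_factors us w].

Lemma factorsP w : lyndon_factors (factors w) w.
Proof.
have [us usP] := lyndon_factorization w.
by apply: (@xgetPex _ [::] [set us | lyndon_factors us w]); exists us.
Qed.

Lemma factorsE us w : lyndon_factors us w -> factors w = us.
Proof. exact: lyndon_factors_uniq (factorsP w). Qed.

Lemma word_typeE w lam : word_type w lam <-> lam = sort geq (map size (factors
  w)).
Proof.
split=> [[us [wE L S ->]]|->]; first by rewrite (@factorsE us).
by have [wE L S] := factorsP w; exists (factors w).
Qed.

(** ** Lyndon rotations *)

Definition is_rot (u x : seq nat) : Prop := exists2 c,
  (c <= size u)%N & x = rot c u.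

Lemma is_rot_sym u x : is_rot u x -> is_rot x u.
Proof.
move=> [c cu ->]; exists (size u - c)%N; first by rewrite size_rot leq_subr.
by rewrite -{1}(rotK c u) /rotr size_rot.
Qed.

Lemma is_rot_trans u v x : is_rot u v -> is_rot v x -> is_rot u x.
Proof.
move=> [c cu ->] [d]; rewrite size_rot => du ->; rewrite rot_add_mod //.
exists (if (d + c <= size u)%N then d + c else d + c - size u)%N => //.
by case: ifP => //; lia.
Qed.

Lemma lyndon_is_rot x y : lyndon x -> lyndon y -> is_rot x y -> x = y.
Proof.
move=> xL yL [c]; rewrite leq_eqVlt => /orP[/eqP ->|cx] yE.
  by rewrite yE rot_size.
have e := esym yE; have c0 := lyndon_rot_eq xL yL e cx.
by rewrite yE c0 rot0.
Qed.

Definition lyndon_rotation (u : seq nat) : seq nat :=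
  xget [::] [set x | lyndon x /\ is_rot u x].

Lemma lyndon_rotationE u x : lyndon x -> is_rot u x -> lyndon_rotation u = x.
Proof.
move=> xL ux; apply: xget_unique => //= y [yL uy].
exact: lyndon_is_rot yL xL (is_rot_trans (is_rot_sym uy) ux).
Qed.

(** The least rotation of a primitive word is less than all the others. *)
Lemma lyndon_rotation_ex u : u <> [::] ->
  (forall c, (0 < c < size u)%N -> rot c u <> u) ->
    exists2 x, lyndon x & is_rot u x.
Proof.
move=> u0 prim.
case: (@arg_minP _ _ 'I_(size u).+1 ord0 xpredT (fun i =>
  rot i u : seqlexi nat)) => // i _ imin.
have iu : (i <= size u)%N by rewrite -ltnS.
exists (rot i u); last by exists i.
split=> [/(congr1 size)|x y x0 y0 E]; first by rewrite size_rot; case: (u) u0.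
have sE : (size x + size y = size u)%N by rewrite -size_cat -E size_rot.
have x1 : (0 < size x)%N by case: (x) x0.
have y1 : (0 < size y)%N by case: (y) y0.
have yxE : y ++ x = rot (size x) (rot i u) by rewrite E rot_size_cat.
rewrite wltNge; apply/negP => le.
have [c cu e] : is_rot u (y ++ x).
  by apply: (is_rot_trans (v := rot i u)); [exists i|exists (size x);
    rewrite ?size_rot //; lia].
have le' : word_le (rot i u) (y ++ x).
  by rewrite e; apply: (imin (Ordinal (cu : (c < (size u).+1)%N))).
have ee : y ++ x = rot i u by apply: wge_anti; rewrite le le'.
apply: (prim (size x)); first by lia.
by apply: (@rot_inj i); rewrite -rot_rot -yxE.
Qed.

(** ** Relabelling the letters *)

(** Renaming the letters keeps a word primitive, but need not keep it Lyndon,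
    whence the rotations; nor does it keep the factors in decreasing order. *)
Definition relabel (phi : nat -> nat) (w : seq nat) : seq nat :=
  flatten (sort word_ge [seq lyndon_rotation (map phi u) | u <- factors w]).

Section Relabel.
Variables (phi psi : nat -> nat) (w : seq nat).
Hypothesis phiK : {in w, cancel phi psi}.

Let mapK u : {subset u <= w} -> map psi (map phi u) = u.
Proof.
move=> uw; rewrite -map_comp -[RHS]map_id; apply/eq_in_map => x /uw;
  exact: phiK.
Qed.

Let subw u : u \in factors w -> {subset u <= w}.
Proof.
have [wE _ _] := factorsP w; move=> uP x xu; rewrite wE.
by apply/flattenP; exists u.
Qed.

Let rotP u : u \in factors w ->
  lyndon (lyndon_rotation (map phi u)) /\ is_rot (map phi u) (lyndon_rotation
    (map phi u)).
Proof.
move=> uP; have [_ L _] := factorsP w; have uL := L u uP.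
have [|c cu e|x xL xr] := @lyndon_rotation_ex (map phi u).
- by move/(congr1 size); rewrite size_map => /size0nil; have [u0 _] := uL.
- rewrite size_map in cu; have := lyndon_rot uL cu.
  have uw := subw uP.
  have ruw : {subset rot c u <= w} by move=> y; rewrite mem_rot; apply: uw.
  by move/(congr1 (map psi)): e; rewrite -map_rot (mapK ruw) (mapK uw) => ->;
    rewrite wlt_irr.
by rewrite (lyndon_rotationE xL xr).
Qed.

Let factors_relabel : factors (relabel phi w) =
  sort word_ge [seq lyndon_rotation (map phi u) | u <- factors w].
Proof.
apply: factorsE; split=> //; last exact: sort_sorted wge_total _.
by move=> x; rewrite mem_sort => /mapP[u /rotP[uL _] ->].
Qed.

Lemma relabel_perm : perm_eq (relabel phi w) (map phi w).
Proof.
have [wE _ _] := factorsP w; rewrite /relabel.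
have : perm_eq (sort word_ge [seq lyndon_rotation (map phi u) | u <- factors w])
  [seq lyndon_rotation (map phi u) | u <- factors w] by rewrite perm_sort.
move=> /(perm_flatten) /perm_trans; apply.
rewrite [X in map phi X]wE map_flatten.
have : forall u, u \in factors w ->
  perm_eq (lyndon_rotation (map phi u)) (map phi u).
  by move=> u /rotP[_ [c _ {1}->]]; rewrite perm_rot.
elim: (factors w) => //= u us IH H; apply: perm_cat; first by apply: H;
  exact: mem_head.
by apply: IH => v vus; apply: H; rewrite inE vus orbT.
Qed.

Lemma relabel_type lam : word_type w lam -> word_type (relabel phi w) lam.
Proof.
rewrite !word_typeE factors_relabel => ->.
apply/(perm_sortP geq_total geq_trans geq_anti).
rewrite perm_sym; apply: (perm_trans (y := map size [seq lyndon_rotation (map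
  phi u) | u <- factors w])).
  by apply: perm_map; rewrite perm_sort.
rewrite -map_comp; rewrite (iffLR (eq_in_map _ size _)) // =>
  u /rotP[_ [c _ e]] /=.
by rewrite e size_rot size_map.
Qed.

Lemma relabelK : relabel psi (relabel phi w) = w.
Proof.
have [wE L S] := factorsP w; rewrite {1}/relabel factors_relabel [RHS]wE;
  congr flatten.
apply: (sorted_eq wge_trans wge_anti) => //;
  first exact: sort_sorted wge_total _.
rewrite perm_sort.
apply: (perm_trans (y := [seq lyndon_rotation (map psi x) | x <-
    [seq lyndon_rotation (map phi u) | u <- factors w]])).
  by apply: perm_map; rewrite perm_sort.
rewrite -map_comp (iffLR (eq_in_map _ id _)) ?map_id // => u uP /=.
have [_ [c cu e]] := rotP uP.
apply: lyndon_rotationE; first exact: L.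
apply: is_rot_sym; exists c; first by rewrite size_map in cu.
by rewrite e map_rot mapK //; apply: subw.
Qed.

End Relabel.

Lemma leq_type_relabel phi psi w lam : {in w, cancel phi psi} ->
  (count (fun v => `[< word_type v lam >]) (permutations w) <=
   count (fun v => `[< word_type v lam >]) (permutations (map phi w)))%N.
Proof.
move=> K; rewrite -!size_filter; apply: (@leq_size_inj _ _ (relabel phi)).
- by rewrite filter_uniq ?permutations_uniq.
- move=> v v'; rewrite !mem_filter !mem_permutations =>
    /andP[_ vw] /andP[_ v'w].
  move/(congr1 (relabel psi)); rewrite !relabelK // => x.
    by rewrite (perm_mem v'w); apply: K.
  by rewrite (perm_mem vw); apply: K.
- move=> v; rewrite !mem_filter !mem_permutations => /andP[/asboolP vt vw].
  have K' : {in v, cancel phi psi} by move=> x; rewrite (perm_mem vw); apply: K.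
  rewrite (perm_trans (relabel_perm K')) ?perm_map // andbT.
  exact/asboolP/(relabel_type K').
Qed.

(** List the letters of each word by increasing multiplicity; phi matches the
    lists. *)
Lemma relabelling (w w' : seq nat) :
  perm_eq (mults (seq_mset w)) (mults (seq_mset w')) ->
  exists phi psi, {in w, cancel phi psi} /\ perm_eq (map phi w) w'.
Proof.
move=> ww'.
have {}ww' : perm_eq [seq count_mem i w | i <- undup w] [seq count_mem i w' | i
  <- undup w'].
  by rewrite -(permPl (perm_mults w)) (permPl ww') perm_mults.
pose S (v : seq nat) := sort (relpre (fun i => count_mem i v) leq) (undup v).
have SE (v : seq nat) : [seq count_mem i v | i <- S v] = sort leq [seq count_mem
  i v | i <- undup v].
  by rewrite sort_map.
have SS : [seq count_mem i w | i <- S w] = [seq count_mem i w' | i <- S w'].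
  by rewrite !SE; apply/(perm_sortP leq_total leq_trans anti_leq).
have Ssize : size (S w) = size (S w') by rewrite -(size_map (fun i =>
  count_mem i w)) SS size_map.
have Smem (v : seq nat) x : (x \in S v) = (x \in v) by rewrite mem_sort
  mem_undup.
have Suniq (v : seq nat) : uniq (S v) by rewrite sort_uniq undup_uniq.
pose phi x := nth 0%N (S w') (index x (S w)).
pose psi x := nth 0%N (S w) (index x (S w')).
have iw x : x \in w -> (index x (S w) < size (S w'))%N.
  by rewrite -Smem -Ssize index_mem.
have K : {in w, cancel phi psi}.
  move=> x xw; rewrite /psi /phi index_uniq ?iw // nth_index // Smem //.
exists phi, psi; split=> //.
have phiS : map phi (S w) = S w'.
  apply: (@eq_from_nth _ 0%N); first by rewrite size_map.
  move=> i; rewrite size_map => iS.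
  by rewrite (nth_map 0%N) // /phi index_uniq.
have cE : {in S w, (fun i => count_mem i w) =1 (fun i => count_mem (phi i) w')}.
  by apply/eq_in_map; rewrite SS -phiS -map_comp.
have flatS (v : seq nat) : perm_eq (flatten [seq nseq (count_mem i v) i | i <- S
  v]) v.
  apply: (perm_trans _ (perm_count_undup v)); apply/perm_flatten/perm_map.
  by rewrite perm_sort.
apply: (perm_trans _ (flatS w')); rewrite perm_sym -phiS -map_comp.
apply: (perm_trans _ (perm_map phi (flatS w))); rewrite map_flatten -map_comp.
rewrite (iffLR (eq_in_map _ (map phi \o (fun i =>
  nseq (count_mem i w) i)) _)) // => i iS /=.
by rewrite map_nseq cE.
Qed.

Lemma sym_L_sym lam : symmetric_series (sym_L lam).
Proof.
move=> m m'; have [w _ <-] := sorted_mset m;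
  have [w' _ <-] := sorted_mset m' => mm'.
rewrite /sym_L word_sumE !wsum_seq !sum_natr_count; congr _%:R.
have le v v' : perm_eq (mults (seq_mset v)) (mults (seq_mset v')) ->
    (count (fun x => `[< word_type x lam >]) (permutations v) <=
     count (fun x => `[< word_type x lam >]) (permutations v'))%N.
  move=> /relabelling[phi [psi [K pv]]].
  apply: leq_trans (leq_type_relabel lam K) _.
  by rewrite (seq.permP (perm_permutations pv)).
by apply/eqP; rewrite eqn_leq !le // perm_sym.
Qed.

Lemma sym_L_homog n lam : part_of n lam -> homogeneous n (sym_L lam).
Proof.
move=> /andP[_ /eqP sl] m mn;
  rewrite /sym_L word_sumE /wsum big_seq big1 // => w.
rewrite mem_permutations => /perm_size sw; case: asboolP => // /word_type_part.
by rewrite sw => /andP[_]; rewrite sl eq_sym (negPf mn).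
Qed.

(** * The coefficients of h_1^n and L_lam *)

Lemma part_word_ones n : part_word (nseq n 1%N) = iota 0 n.
Proof.
rewrite /part_word /block_word size_nseq -[RHS]flatten_seq1; congr flatten.
by apply/eq_in_map => i; rewrite mem_iota add0n nth_nseq => /andP[_ ->].
Qed.

Lemma sym_h1X n : sym_h 1 ^+ n = prod_h (nseq n 1%N).
Proof. by rewrite /prod_h big_nseq iter_mulr_1. Qed.

Lemma hspan_h1X n : hspan n (sym_h 1 ^+ n).
Proof.
rewrite sym_h1X; apply: hspan_prod.
by rewrite /comp_of sumn_nseq mul1n eqxx andbT mem_nseq andbF.
Qed.

Lemma sym_h1X_coef l : sorted leq l ->
  (sym_h 1 ^+ size l) (seq_mset l) =
  #|[set pi : 'S_(size l) | biw l (perm_word pi)]%SET|%:R.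
Proof.
move=> sl; rewrite sym_h1X -wsum_biw_part part_word_ones wsum_biw_sym
  ?iota_sorted //.
by rewrite wsum_seq sum_natr_count count_perm_words.
Qed.

Lemma sym_L_coef l lam : sorted leq l -> part_of (size l) lam ->
  sym_L lam (seq_mset l) =
  #|[set pi : 'S_(size l) | (cycle_type pi == lam) && biw l (perm_word
    pi)]%SET|%:R.
Proof.
by move=> sl lamP; rewrite /sym_L word_sumE wsum_seq sum_natr_count
  gessel_reutenauer.
Qed.

Theorem theorem6p4 (k : nat) (hk : (2 <= k)%N) :
  [/\
      forall n : nat, (0 < n)%N ->
        (#|[set pi : 'S_n | avoids k pi]%SET|)%:R
          = hall (sym_h 1 ^+ n) (gtilde k n),
      forall (n : nat) (lam : seq nat), (0 < n)%N -> part_of n lam ->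
        (#|[set pi : 'S_n | avoids k pi && (cycle_type pi == lam)]%SET|)%:R
          = hall (sym_L lam) (gtilde k n),
      forall n : nat,
        gtilde k n
          = \sum_(mu \in [set mu | comp_of n mu]) chi_comp k mu *: prod_e mu
    & exists Sg Se : pser,
        [/\ pser_sum (gtilde k) Sg,
            pser_sum (fun r => chi k r.+1 *: sym_e r.+1) Se,
            (* Sg is the inverse of 1 - Se *)
            Sg * (1 - Se) = 1
          & pser_sum (alt_e k) (1 - Se)]].
Proof.
split.
- move=> n n0; rewrite -(hall_gtilde (P := predT) hk n0 (hspan_h1X n)).
    by congr (_%:R); apply: eq_card => pi; rewrite !inE andbT.
  by move=> l <- sl; rewrite sym_h1X_coef.
- move=> n lam n0 lamP.
  have hL : hspan n (sym_L lam).
    by apply: symmetric_hspan n0 (@sym_L_sym lam) (sym_L_homog lamP).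
  rewrite -(hall_gtilde (P := fun pi => cycle_type pi == lam) hk n0 hL) //.
  by move=> l ln sl; subst n; apply: sym_L_coef.
- by move=> n; apply: gtilde_compositions.
- exact: gtilde_series.
Qed.
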